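(* Let $n\geqslant 2$ be an integer and let $\alpha\in(0,2]$, $\alpha<n$. For any set $A\subset\mathbb{R}^n$ and any $c_\alpha$-absolutely continuous measures $\mu,\nu\in\mathfrak{M}^+_A$ such that $\kappa_\alpha\mu\leqslant\kappa_\alpha\nu$ nearly everywhere on $A$, we have $\mu(\mathbb{R}^n)\leqslant\nu(\mathbb{R}^n)$ (as elements of $[0,+\infty]$).
   Context: Kernel and potential: $\kappa_\alpha(x,y):=|x-y|^{\alpha-n}$ is the $\alpha$-Riesz kernel on $\mathbb{R}^n$ ($|x-y|$ the Euclidean distance, $\kappa_\alpha(x,x)=+\infty$). For a positive Radon measure $\mu$ on $\mathbb{R}^n$, $\kappa_\alpha\mu(x):=\int\kappa_\alpha(x,y)\,d\mu(y)\in[0,+\infty]$. $\mathfrak{M}^+$ is the cone of all positive Radon measures $\mu$ on $\mathbb{R}^n$ (possibly with $\mu(\mathbb{R}^n)=+\infty$) such that $\kappa_\alpha\mu$ is not identically $+\infty$; equivalently, $\int_{|y|>1}|y|^{\alpha-n}\,d\mu(y)<\infty$. A measure $\mu\in\mathfrak{M}^+$ is concentrated on $A\subset\mathbb{R}^n$ if $A^c:=\mathbb{R}^n\setminus A$ is $\mu$-negligible (equivalently, $A$ is $\mu$-measurable and $\mu=\mu|_A$, the restriction of $\mu$ to $A$). $\mathfrak{M}^+_A$ is the cone of all $\mu\in\mathfrak{M}^+$ concentrated on $A$. Inner capacity: let $\mathcal{E}^+_A$ be the set of all $\mu\in\mathfrak{M}^+_A$ with finite energy $\kappa_\alpha(\mu,\mu):=\int\kappa_\alpha(x,y)\,d(\mu\otimes\mu)(x,y)<\infty$.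 The inner $\alpha$-Riesz capacity of an arbitrary $A\subset\mathbb{R}^n$ is $c_\alpha(A):=1/\inf\kappa_\alpha(\mu,\mu)$, the infimum being over all $\mu\in\mathcal{E}^+_A$ with $\mu(\mathbb{R}^n)=1$, with the conventions $\inf\varnothing=+\infty$, $1/(+\infty)=0$, $1/0=+\infty$. A property holds nearly everywhere (n.e.) on $A$ if the set $E$ of all $x\in A$ where it fails satisfies $c_\alpha(E)=0$. A measure $\mu\in\mathfrak{M}^+$ is $c_\alpha$-absolutely continuous if $\mu(K)=0$ for every compact set $K\subset\mathbb{R}^n$ with $c_\alpha(K)=0$. *)

(* Defs.v *)
From HB Require Import structures.
From mathcomp Require Import all_boot all_order all_algebra.
From mathcomp Require Import all_classical all_reals all_analysis.

Set Implicit Arguments.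
Unset Strict Implicit.
Unset Printing Implicit Defensive.

Import Order.TTheory GRing.Theory Num.Theory.
Import numFieldNormedType.Exports.

Local Open Scope classical_set_scope.
Local Open Scope ring_scope.

(* R^n with its Borel sigma-algebra.  The topology of 'rV[R]_n comes from the
   sup norm, hence is the Euclidean one. *)
Notation borelRn R n := (g_sigma_algebraType (@open 'rV[R]_n)).

(* The library norm on 'rV[R]_n is the sup norm, so the Euclidean distance has
   to be written out. *)
Definition euclidean_dist (R : realType) (n : nat) (x y : 'rV[R]_n) : R :=
  Num.sqrt (\sum_(i < n) (x 0 i - y 0 i) ^+ 2).

Definition riesz_kernel (R : realType) (n : nat) (alpha : R)
    (x y : 'rV[R]_n) : \bar R :=
  if x == y then +oo%E else ((euclidean_dist x y) `^ (alpha - n%:R))%:E.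

Definition riesz_potential (R : realType) (n : nat) (alpha : R)
    (mu : {measure set (borelRn R n) -> \bar R}) (x : 'rV[R]_n) : \bar R :=
  (\int[mu]_y riesz_kernel alpha x y)%E.

Definition riesz_energy (R : realType) (n : nat) (alpha : R)
    (mu : {measure set (borelRn R n) -> \bar R}) : \bar R :=
  (\int[mu \x mu]_z riesz_kernel alpha z.1 z.2)%E.

Definition radon (R : realType) (n : nat)
    (mu : {measure set (borelRn R n) -> \bar R}) : Prop :=
  (forall K : set 'rV[R]_n, compact K -> (mu K < +oo)%E) /\
  (forall B : set (borelRn R n), measurable B ->
    mu B = ereal_sup [set mu K | K in [set K : set 'rV[R]_n |
                                        compact K /\ K `<=` B]]).

(* The cone M^+. *)
Definition radon_finite_potential (R : realType) (n : nat) (alpha : R)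
    (mu : {measure set (borelRn R n) -> \bar R}) : Prop :=
  radon mu /\ exists x : 'rV[R]_n, riesz_potential alpha mu x <> +oo%E.

(* [mu.-negligible] does not require measurability, so A is arbitrary. *)
Definition concentrated (R : realType) (n : nat)
    (mu : {measure set (borelRn R n) -> \bar R}) (A : set 'rV[R]_n) : Prop :=
  mu.-negligible (~` A).

(* The cone M^+_A. *)
Definition radon_on (R : realType) (n : nat) (alpha : R) (A : set 'rV[R]_n)
    (mu : {measure set (borelRn R n) -> \bar R}) : Prop :=
  radon_finite_potential alpha mu /\ concentrated mu A.

(* The set E^+_A. *)
Definition finite_energy_on (R : realType) (n : nat) (alpha : R)
    (A : set 'rV[R]_n) (mu : {measure set (borelRn R n) -> \bar R}) : Prop :=
  radon_on alpha A mu /\ (riesz_energy alpha mu < +oo)%E.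

(* [ereal_inf set0 = +oo], and the inverse of \bar R satisfies
   [0^-1 = +oo] and [+oo^-1 = 0]. *)
Definition inner_capacity (R : realType) (n : nat) (alpha : R)
    (A : set 'rV[R]_n) : \bar R :=
  ((ereal_inf [set riesz_energy alpha mu |
      mu in [set mu : {measure set (borelRn R n) -> \bar R} |
              finite_energy_on alpha A mu /\ mu setT = 1%E]])^-1)%E.

Definition nearly_everywhere (R : realType) (n : nat) (alpha : R)
    (A : set 'rV[R]_n) (P : 'rV[R]_n -> Prop) : Prop :=
  inner_capacity alpha [set x | A x /\ ~ P x] = 0%E.

Definition capacity_absolutely_continuous (R : realType) (n : nat) (alpha : R)
    (mu : {measure set (borelRn R n) -> \bar R}) : Prop :=
  forall K : set 'rV[R]_n,
    compact K -> inner_capacity alpha K = 0%E -> mu K = 0%E.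

(* Main.v *)
Require Import Defs.
From HB Require Import structures.
From mathcomp Require Import all_boot all_order all_algebra.
From mathcomp Require Import all_classical all_reals all_analysis.
From mathcomp Require Import measurable_realfun ring lra.

Import Order.TTheory GRing.Theory Num.Theory.
Import numFieldNormedType.Exports.

(** Let k denote the Riesz kernel and k mu the potential of mu.  For a compact set
    K, let gamma be its equilibrium measure: k gamma is 1 on K up to a set of
    capacity zero, and at most 1 everywhere.  By the symmetry of the kernel,

      mu(K) <= int k gamma dmu = int k mu dgamma
            <= int k nu dgamma = int k gamma dnu <= nu(R^n),

    provided that k mu <= k nu holds gamma-almost everywhere, and the theorem
    follows by letting K exhaust the space up to mu-null sets.

    An approximate equilibrium measure is enough, and it is sought among the
    measures f mu, where f is a bounded density living on a large compact part
    B of K.  For such a measure the middle inequality follows from k mu <= k nu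
    mu-almost everywhere ([ae_potential_le]): the part in A of the exceptional
    set has inner capacity zero, so that mu does not charge its compact subsets.

    For the construction of f, the set where k mu is infinite is first seen to be
    mu-null ([polar_infinity]).  By Egorov's theorem, B can then be chosen such that
    the potential of mu restricted to B is the uniform limit of its regularisations
    ([exists_uniform_piece]); the potentials of bounded densities on B are then
    continuous.  One wants f >= 0 with e f + k(f mu) = 1 where f > 0, and >= 1 on
    all of B, for a small e > 0.  On a fine partition of B this becomes a finite
    problem, solved by minimising a quadratic form ([discrete_obstacle]).  Since k is
    bounded below on B, the mass of f mu is bounded independently of e; thus e f
    is small in mean, and k(f mu) is close to 1 on most of B.

    Finally k(f mu) is nearly at most 1 where f > 0, hence everywhere, by Frostman's
    maximum principle ([frostman_maximum_principle]).  This is where alpha <= 2 is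
    used: for these alpha the kernel is subharmonic away from its pole. *)

Local Open Scope classical_set_scope.
Local Open Scope ring_scope.

Set Implicit Arguments.
Unset Strict Implicit.
Unset Printing Implicit Defensive.

(** * Inequalities for inverse powers *)

(** The inverse power is convex, hence above its tangents: Bernoulli's inequality
    for a negative exponent, from [exp x >= 1 + x] and [ln (1 + x) <= x]. *)
Lemma powRN_tangent (R : realType) (b s t : R) : 0 < b -> 0 < s -> 0 < t ->
  s `^ (- b) - b * s `^ (- b) / s * (t - s) <= t `^ (- b).
Proof.
move=> b0 s0 t0; have u0 : 0 < t / s by rewrite divr_gt0.
have -> : t `^ (- b) = s `^ (- b) * (t / s) `^ (- b).
  by rewrite -powRM ?(ltW s0) ?(ltW u0)// mulrC divfK// gt_eqF.
have Hln : ln (t / s) <= t / s - 1.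
  have -> : ln (t / s) = ln (1 + (t / s - 1)) by rewrite addrCA subrr addr0.
  by apply: le_ln1Dx; lra.
have Hexp : 1 - b * (t / s - 1) <= (t / s) `^ (- b).
  rewrite /powR gt_eqF//; apply: le_trans (expR_ge1Dx _).
  by rewrite lerD2l mulNr lerN2 ler_pM2l.
have -> : s `^ (- b) - b * s `^ (- b) / s * (t - s)
    = s `^ (- b) * (1 - b * (t / s - 1)) by field; rewrite gt_eqF.
by rewrite ler_pM2l// powR_gt0.
Qed.

Lemma powRN_le (R : realType) (b s t : R) : 0 < b -> 0 < s -> s <= t ->
  t `^ (- b) <= s `^ (- b).
Proof.
move=> b0 s0 st; have t0 := lt_le_trans s0 st.
rewrite !powRN lef_pV2 ?posrE ?powR_gt0//.
by apply: ge0_ler_powR; rewrite ?nnegrE// ltW.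
Qed.

Lemma powRN_scale (R : realType) (b c s : R) : 0 < c -> 0 < s ->
  (c * s) `^ (- b) = c `^ (- b) * s `^ (- b).
Proof. by move=> c0 s0; rewrite powRM ?ltW. Qed.

(** Writing [t = r * s] with [r >= 1], homogeneity turns the left side into
    [r `^ (- b)] times the increment at [s] with the smaller step [h / r]. *)
Lemma powRN_diff_le (R : realType) (b s t h : R) :
  0 < b -> 0 < s -> s <= t -> 0 <= h ->
  t `^ (- b) - (t + h) `^ (- b) <= s `^ (- b) - (s + h) `^ (- b).
Proof.
move=> b0 s0 st h0; have t0 := lt_le_trans s0 st.
pose r := t / s; have r0 : 0 < r by rewrite divr_gt0.
have r1 : 1 <= r by rewrite /r ler_pdivlMr// mul1r.
have tE : t = r * s by rewrite /r divfK// gt_eqF.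
have thE : t + h = r * (s + h / r) by rewrite mulrDr -tE mulrC divfK// gt_eqF.
have hr : h / r <= h by rewrite ler_pdivrMr// ler_peMr.
have hr0 : 0 <= h / r by rewrite divr_ge0// ltW.
have shr : 0 < s + h / r by lra.
have -> : t `^ (- b) = r `^ (- b) * s `^ (- b) by rewrite -powRN_scale// -tE.
have -> : (t + h) `^ (- b) = r `^ (- b) * (s + h / r) `^ (- b).
  by rewrite -powRN_scale// -thE.
have A : (s + h) `^ (- b) <= (s + h / r) `^ (- b) by apply: powRN_le => //; lra.
have B : (s + h / r) `^ (- b) <= s `^ (- b) by apply: powRN_le => //; lra.
have C : r `^ (- b) <= 1 `^ (- b) by apply: powRN_le.
rewrite powR1 in C.
have D : 0 <= r `^ (- b) by exact: powR_ge0.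
nra.
Qed.

Lemma ge0_of_derive (R : realType) (f df : R -> R) (v : R) :
  0 <= v -> f 0 = 0 ->
  (forall x, 0 <= x <= v -> is_derive x 1 f (df x)) ->
  (forall x, 0 <= x <= v -> 0 <= df x) -> 0 <= f v.
Proof.
move=> v0 f0 Df df0.
have [||c] := @MVT_segment R f df 0 v v0.
- by move=> x; rewrite in_itv/= => /andP[/ltW ? /ltW ?]; apply: Df; apply/andP.
- apply: derivable_within_continuous => x; rewrite in_itv/= => xv.
  by have [] := Df x xv.
- by rewrite in_itv/= f0 !subr0 => /df0 d0 ->; rewrite mulr_ge0.
Qed.

(** The right side is even in [v] and all its Taylor coefficients are positive.
    Here the sign of the remainder is integrated twice, starting from the
    tangent inequality for the exponent [b + 2]. *)
Lemma powRN_sym_ge (R : realType) (b v : R) : 0 < b -> 0 <= v < 1 ->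
  2 + b * (b + 1) * v ^+ 2 <= (1 + v) `^ (- b) + (1 - v) `^ (- b).
Proof.
move=> b0 /andP[v0 v1].
pose f (x : R) := (1 + x) `^ (- b) + (1 - x) `^ (- b) - 2 - b * (b + 1) * x ^+ 2.
pose f1 (x : R) := - b * (1 + x) `^ (- b - 1) + b * (1 - x) `^ (- b - 1)
   - 2 * b * (b + 1) * x.
pose f2 (x : R) := b * (b + 1) * ((1 + x) `^ (- b - 2) + (1 - x) `^ (- b - 2) - 2).
suff : 0 <= f v by rewrite /f; lra.
have Dp p (x : R) : 0 <= x <= v ->
    is_derive x 1 (fun y : R => (1 + y) `^ p) (p * (1 + x) `^ (p - 1)).
  move=> xv; have := @is_derive1_comp R (@powR R ^~ p) (fun y => 1 + y) x
    (p * (1 + x) `^ (p - 1)) 1.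
  rewrite mulr1; apply; first by apply: is_derive1_powR; lra.
  by apply: is_derive_eq; ring.
have Dm p (x : R) : 0 <= x <= v ->
    is_derive x 1 (fun y : R => (1 - y) `^ p) (- (p * (1 - x) `^ (p - 1))).
  move=> xv; have := @is_derive1_comp R (@powR R ^~ p) (fun y => 1 - y) x
    (p * (1 - x) `^ (p - 1)) (- 1).
  rewrite mulrN mulr1; apply; first by apply: is_derive1_powR; lra.
  by apply: is_derive_eq; ring.
apply: (@ge0_of_derive R f f1 v) => //.
- by rewrite /f addr0 subr0 powR1 expr0n/= mulr0; lra.
- move=> x xv; have D1 := Dp (- b) x xv; have D2 := Dm (- b) x xv.
  apply: is_derive_eq; rewrite /f1 /GRing.scale/=; ring.
move=> x /andP[x0 xv]; apply: (@ge0_of_derive R f1 f2 x) => //.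
- rewrite /f1 addr0 subr0 powR1; ring.
- move=> y /andP[y0 yx]; have yv : 0 <= y <= v by lra.
  have D1 := Dp (- b - 1) y yv; have D2 := Dm (- b - 1) y yv.
  have E : - b - 2 = - b - 1 - 1 by ring.
  apply: is_derive_eq; rewrite /f2 E /GRing.scale/=; ring.
move=> y /andP[y0 yx]; rewrite /f2 mulr_ge0//; first by rewrite mulr_ge0//; lra.
have b2 : 0 < b + 2 by lra.
have := @powRN_tangent R (b + 2) 1 (1 + y) b2; have := @powRN_tangent R (b + 2) 1 (1 - y) b2.
rewrite !powR1 (_ : - (b + 2) = - b - 2); last by ring.
by move=> /(_ ltr01)H1 /(_ ltr01)H2; have := H1 ltac:(lra); have := H2 ltac:(lra); lra.
Qed.

(** The second-difference Laplacian, with step [d], of the function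
    [x |-> |x - y| ^ (- 2 b)], where [z = x - y].  Its term of order [d ^+ 2] is
    a positive multiple of [2 * b + 2 - n], which equals [2 - alpha] for the
    Riesz kernel: this is where [alpha <= 2] enters.  What remains is an error
    of order [d ^+ 4]. *)
Lemma powRN_second_difference (R : realType) (n : nat) (b s d : R) (z : 'I_n -> R) :
  0 < b -> n%:R <= 2 * b + 2 -> \sum_i z i ^+ 2 = s -> 0 < s -> 0 < d ->
  d ^+ 2 < s -> b * d ^+ 2 <= s ->
  (2 * n%:R - (8 * b * (b + 1) + 4 * b ^+ 2 * (b + 1)) * (d ^+ 2 / s) ^+ 2)
    * s `^ (- b) <=
  \sum_i ((s + d ^+ 2 + 2 * d * z i) `^ (- b)
          + (s + d ^+ 2 - 2 * d * z i) `^ (- b)).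
Proof.
move=> b0 nb zs s0 d0 ds bds.
set a := s + d ^+ 2; have d20 : 0 < d ^+ 2 by rewrite exprn_gt0.
have a0 : 0 < a by rewrite /a; lra.
pose v i := 2 * d * z i / a.
have zis i : z i ^+ 2 <= s.
  by rewrite -zs (bigD1 i)//= lerDl sumr_ge0// => j _; exact: sqr_ge0.
have v1 i : `|v i| < 1.
  rewrite -(@ltr_pXn2r _ 2)// ?nnegrE// expr1n -normrX ger0_norm ?sqr_ge0//.
  rewrite /v expr_div_n ltr_pdivrMr ?exprn_gt0// mul1r.
  have -> : (2 * d * z i) ^+ 2 = 4 * d ^+ 2 * z i ^+ 2 by ring.
  apply: (@le_lt_trans _ _ (4 * d ^+ 2 * s)).
    by rewrite ler_wpM2l// mulr_ge0// ltW.
  rewrite -subr_gt0 /a.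
  have -> : (s + d ^+ 2) ^+ 2 - 4 * d ^+ 2 * s = (s - d ^+ 2) ^+ 2 by ring.
  by rewrite exprn_gt0// subr_gt0.
have E i : a `^ (- b) * (2 + b * (b + 1) * v i ^+ 2) <=
    (a + 2 * d * z i) `^ (- b) + (a - 2 * d * z i) `^ (- b).
  have -> : a + 2 * d * z i = a * (1 + v i) by rewrite /v; field; rewrite gt_eqF.
  have -> : a - 2 * d * z i = a * (1 - v i) by rewrite /v; field; rewrite gt_eqF.
  have /ltr_normlP[vl vr] := v1 i.
  rewrite !powRN_scale//; try lra; rewrite -mulrDr ler_pM2l ?powR_gt0//.
  have [vi0|vi0] := leP 0 (v i); first by apply: powRN_sym_ge; rewrite ?vi0.
  have vi1 : 0 <= - v i < 1 by lra.
  by have := powRN_sym_ge b0 vi1; rewrite sqrrN opprK; lra.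
apply: le_trans (ler_sum _ (fun i _ => E i)).
rewrite -mulr_sumr big_split/= sumr_const card_ord -mulr_sumr.
have -> : \sum_(i < n) v i ^+ 2 = 4 * d ^+ 2 * s / a ^+ 2.
  rewrite -zs mulr_sumr mulr_suml; apply: eq_bigr => i _.
  by rewrite /v; field; rewrite gt_eqF.
pose w := d ^+ 2 / s; have w0 : 0 < w by rewrite divr_gt0.
have aE : a = s * (1 + w) by rewrite /a /w; field; rewrite gt_eqF.
have bw : b * w <= 1 by rewrite /w mulrA ler_pdivrMr// mul1r.
have w1 : 0 < 1 + w by lra.
rewrite -/w.
have -> : 4 * d ^+ 2 * s / a ^+ 2 = 4 * w / (1 + w) ^+ 2.
  by rewrite aE /w; field; rewrite !gt_eqF//= -/w; have := s0; nra.
rewrite aE powRN_scale// [leLHS]mulrC -[leRHS]mulrA ler_pM2l ?powR_gt0//.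
have H1 : 1 - b * w <= (1 + w) `^ (- b).
  have := @powRN_tangent R b 1 (1 + w) b0 ltr01 w1; rewrite powR1; lra.
have H2 : 1 - 2 * w <= ((1 + w) ^+ 2)^-1.
  rewrite -[leRHS]mul1r ler_pdivlMr ?exprn_gt0//; nra.
have H3 : 2 * n%:R + b * (b + 1) * (4 * w * (1 - 2 * w)) <=
   2 *+ n + b * (b + 1) * (4 * w / (1 + w) ^+ 2).
  rewrite mulr_natr lerD2l ler_wpM2l//; first by rewrite mulr_ge0; lra.
  by rewrite ler_wpM2l//; lra.
have n0 : 0 <= n%:R :> R by [].
have P0 : 0 <= 2 *+ n + b * (b + 1) * (4 * w / (1 + w) ^+ 2).
  rewrite addr_ge0// ?mulrn_wge0// !mulr_ge0 ?invr_ge0 ?sqr_ge0//; lra.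
apply: (@le_trans _ _ ((1 - b * w) * (2 *+ n + b * (b + 1) * (4 * w / (1 + w) ^+ 2))));
  last first.
  exact: ler_wpM2r.
apply: (@le_trans _ _ ((1 - b * w) * (2 * n%:R + b * (b + 1) * (4 * w * (1 - 2 * w)))));
  last first.
  by apply: ler_wpM2l => //; lra.
rewrite -subr_ge0.
have -> : (1 - b * w) * (2 * n%:R + b * (b + 1) * (4 * w * (1 - 2 * w))) -
  (2 * n%:R - (8 * b * (b + 1) + 4 * b ^+ 2 * (b + 1)) * w ^+ 2)
  = 2 * b * w * (2 * b + 2 - n%:R) + 8 * b ^+ 2 * (b + 1) * w ^+ 3 by ring.
have b1 : 0 <= b + 1 by lra.
have K : 0 <= 2 * b + 2 - n%:R by lra.
by clearbody w; rewrite addr_ge0// !mulr_ge0 ?exprn_ge0// ltW.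
Qed.

(** * Tonelli's theorem, the Riesz kernel and its regularisations *)

Section sigma_finite_copy.
Context d (T : measurableType d) (R : realType) (mu : {measure set T -> \bar R}).
Context (h : sigma_finite setT mu).

(** Alias of mu, convertible to it, to which the sigma-finite structure can be
    attached because the proof is one of its parameters. *)
Definition sf_copy (_ : sigma_finite setT mu) : set T -> \bar R := mu.

HB.instance Definition _ := isMeasure.Build _ _ _ (sf_copy h)
  (measure0 mu) (measure_ge0 mu) (@measure_semi_sigma_additive _ _ _ mu).

HB.instance Definition _ := Measure_isSigmaFinite.Build _ _ _ (sf_copy h) h.

End sigma_finite_copy.

Section Tonelli.
Context d d' (T : measurableType d) (T' : measurableType d') (R : realType).
Context (mu : {measure set T -> \bar R}) (nu : {measure set T' -> \bar R}).
Context (hmu : sigma_finite setT mu) (hnu : sigma_finite setT nu).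
Context (f : T * T' -> \bar R) (mf : measurable_fun setT f) (f0 : forall z, (0 <= f z)%E).

Lemma tonelli :
  (\int[mu]_x \int[nu]_y f (x, y) = \int[nu]_y \int[mu]_x f (x, y))%E.
Proof. exact: (@fubini_tonelli _ _ _ _ _ (sf_copy hmu) (sf_copy hnu) f mf f0). Qed.

Lemma tonelli_prod : (\int[mu \x nu]_z f z = \int[mu]_x \int[nu]_y f (x, y))%E.
Proof. exact: (@fubini_tonelli1 _ _ _ _ _ (sf_copy hmu) (sf_copy hnu) f mf f0). Qed.

Lemma tonelli_measurable : measurable_fun setT (fun x => \int[nu]_y f (x, y))%E.
Proof. exact: (@measurable_fun_fubini_tonelli_F _ _ _ _ _ (sf_copy hnu) f mf f0). Qed.

End Tonelli.

Section Kernel.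
Context (R : realType) (n : nat).
Implicit Types (x y z : 'rV[R]_n) (b h c : R).

(** The squared Euclidean distance: it is polynomial in the coordinates, and
    powers of the distance are powers of it with half the exponent. *)
Definition sqdist x y : R := \sum_(i < n) (x 0 i - y 0 i) ^+ 2.

Lemma sqdist_ge0 x y : 0 <= sqdist x y.
Proof. by rewrite sumr_ge0// => i _; exact: sqr_ge0. Qed.

Lemma sqdistC x y : sqdist x y = sqdist y x.
Proof. by apply: eq_bigr => i _; ring. Qed.

Lemma sqdist_coord x y i : (x 0 i - y 0 i) ^+ 2 <= sqdist x y.
Proof. by rewrite /sqdist (bigD1 i)//= lerDl sumr_ge0// => j _; exact: sqr_ge0. Qed.

Lemma sqdist_eq0 x y : (sqdist x y == 0) = (x == y).
Proof.
apply/eqP/eqP => [xy|->]; last by rewrite /sqdist big1// => i _; rewrite subrr expr0n.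
apply/rowP => i; apply/eqP; rewrite -subr_eq0 -sqrf_eq0 eq_le sqr_ge0 andbT.
by rewrite -xy sqdist_coord.
Qed.

Lemma sqdist_triangle x y z : sqdist x z <= 2 * sqdist x y + 2 * sqdist y z.
Proof.
rewrite !mulr_sumr -big_split/= ler_sum// => i _.
rewrite -subr_ge0 (_ : _ - _ = (x 0 i - 2 * y 0 i + z 0 i) ^+ 2); last by ring.
exact: sqr_ge0.
Qed.

(** With [b = (n - alpha) / 2] this is the Riesz kernel. *)
Definition kern b x y : \bar R :=
  if x == y then +oo%E else (sqdist x y `^ (- b))%:E.

(** Bounded, uniformly continuous regularisation of [kern], increasing to it as
    [h] decreases to 0. *)
Definition kreg b h x y : R := (sqdist x y + h) `^ (- b).

(** The singular remainder [kern - kreg]; a definition by cases, since [kern] is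
    infinite on the diagonal. *)
Definition kdiff b h x y : \bar R :=
  if x == y then +oo%E else (sqdist x y `^ (- b) - kreg b h x y)%:E.

Lemma riesz_kernelE (alpha : R) x y :
  riesz_kernel alpha x y = kern ((n%:R - alpha) / 2) x y.
Proof.
rewrite /riesz_kernel /kern; case: eqP => // _; congr EFin.
rewrite /euclidean_dist -powR12_sqrt; last exact: sqdist_ge0.
by rewrite -powRrM; congr (_ `^ _); field.
Qed.

Lemma sqdist_gt0 x y : x != y -> 0 < sqdist x y.
Proof. by move=> xy; rewrite lt_def sqdist_ge0 sqdist_eq0 xy. Qed.

Lemma kern_ge0 b x y : (0 <= kern b x y)%E.
Proof. by rewrite /kern; case: ifP => // _; rewrite lee_fin powR_ge0. Qed.

Lemma kernC b x y : kern b x y = kern b y x.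
Proof. by rewrite /kern eq_sym sqdistC. Qed.

Lemma kregC b h x y : kreg b h x y = kreg b h y x.
Proof. by rewrite /kreg sqdistC. Qed.

Lemma kreg_ge0 b h x y : 0 <= kreg b h x y.
Proof. exact: powR_ge0. Qed.

Lemma kreg_le b h x y : 0 < b -> 0 < h -> kreg b h x y <= h `^ (- b).
Proof. by move=> b0 h0; apply: powRN_le => //; rewrite lerDr sqdist_ge0. Qed.

Lemma kdiff_ge0 b h x y : 0 < b -> 0 <= h -> (0 <= kdiff b h x y)%E.
Proof.
move=> b0 h0; rewrite /kdiff; case: ifPn => // xy; rewrite lee_fin subr_ge0.
by apply: powRN_le => //; [exact: sqdist_gt0|rewrite lerDl].
Qed.

Lemma kern_split b h x y : kern b x y = (kdiff b h x y + (kreg b h x y)%:E)%E.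
Proof. by rewrite /kern /kdiff; case: ifP => // _; rewrite -EFinD subrK. Qed.

Lemma kern_le_dilate b c x x' y : 0 < b -> 0 < c ->
  sqdist x' y <= c * sqdist x y -> (kern b x y <= (c^-1 `^ (- b))%:E * kern b x' y)%E.
Proof.
move=> b0 c0 H; have c'0 : 0 < c^-1 by rewrite invr_gt0.
have C0 : 0 < c^-1 `^ (- b) by rewrite powR_gt0.
rewrite /kern; case: (eqVneq x' y) => [|x'y]; first by rewrite gt0_muley// leey.
have xy : x != y.
  apply: contraTneq H => ->; have := sqdist_gt0 x'y.
  by rewrite (eqP (_ : sqdist y y == 0)) ?sqdist_eq0// mulr0 -ltNge.
rewrite (negbTE xy) -EFinM lee_fin -powRN_scale ?sqdist_gt0//.
apply: powRN_le => //; first by rewrite mulr_gt0// sqdist_gt0.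
by rewrite mulrC ler_pdivrMr// mulrC.
Qed.

(** Dividing the squared distance by 4 and the level [h] by 4 at once multiplies
    the remainder by a constant, by homogeneity; moreover the remainder is
    decreasing in the distance. *)
Lemma kdiff_le_dilate b h x x' y : 0 < b -> 0 < h ->
  sqdist x' y <= 4 * sqdist x y ->
  (kdiff b h x y <= (4^-1 `^ (- b))%:E * kdiff b (4 * h) x' y)%E.
Proof.
move=> b0 h0 H.
have C0 : 0 < 4^-1 `^ (- b) :> R by rewrite powR_gt0// invr_gt0.
rewrite /kdiff; case: (eqVneq x' y) => [|x'y]; first by rewrite gt0_muley// leey.
have s'0 := sqdist_gt0 x'y.
have xy : x != y.
  apply: contraTneq H => ->.
  by rewrite (eqP (_ : sqdist y y == 0)) ?sqdist_eq0// mulr0 -ltNge.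
rewrite (negbTE xy) -EFinM lee_fin /kreg mulrBr -!powRN_scale; try lra.
have -> : 4^-1 * (sqdist x' y + 4 * h) = 4^-1 * sqdist x' y + h by field.
by apply: powRN_diff_le; lra.
Qed.

Definition box (L : R) : set 'rV[R]_n := [set v : 'rV[R]_n | forall i, `|v 0 i| <= L].

Lemma sqdist_lip (L r : R) x x' y y' :
  box L x -> box L x' -> box L y -> box L y' ->
  (forall i, `|x 0 i - x' 0 i| <= r) -> (forall i, `|y 0 i - y' 0 i| <= r) ->
  `|sqdist x y - sqdist x' y'| <= n%:R * (8 * L * r).
Proof.
move=> xL x'L yL y'L xr yr; rewrite -sumrB.
apply: le_trans (ler_norm_sum _ _ _) _.
apply: (@le_trans _ _ (\sum_(i < n) 8 * L * r)); last first.
  by rewrite sumr_const card_ord [leRHS]mulr_natl.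
apply: ler_sum => i _.
have -> : (x 0 i - y 0 i) ^+ 2 - (x' 0 i - y' 0 i) ^+ 2 =
   ((x 0 i - x' 0 i) - (y 0 i - y' 0 i)) * (x 0 i - y 0 i + x' 0 i - y' 0 i) by ring.
have A : `|(x 0 i - x' 0 i) - (y 0 i - y' 0 i)| <= 2 * r.
  by apply: le_trans (ler_normB _ _) _; have := xr i; have := yr i; lra.
have B : `|x 0 i - y 0 i + x' 0 i - y' 0 i| <= 4 * L.
  move: (xL i) (x'L i) (yL i) (y'L i); rewrite !ler_norml; lra.
rewrite normrM (_ : 8 * L * r = 2 * r * (4 * L)); last by ring.
by apply: ler_pM.
Qed.

Lemma kreg_lip b h x y x' y' : 0 < b -> 0 < h ->
  `|kreg b h x y - kreg b h x' y'| <= b * h `^ (- b) / h * `|sqdist x y - sqdist x' y'|.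
Proof.
move=> b0 h0.
have aux s t : 0 <= s -> 0 <= t ->
   (s + h) `^ (- b) - (t + h) `^ (- b) <= b * h `^ (- b) / h * `|s - t|.
  move=> s0 t0; have sh : 0 < s + h by lra. have th : 0 < t + h by lra.
  have := powRN_tangent b0 sh th.
  rewrite lerBlDl -lerBlDr => H; apply: le_trans H _.
  have -> : t + h - (s + h) = t - s by ring.
  have K : (s + h) `^ (- b) / (s + h) <= h `^ (- b) / h.
    apply: ler_pM; [exact: powR_ge0 | by rewrite invr_ge0 ltW | |].
      by apply: powRN_le => //; lra.
    by rewrite lef_pV2 ?posrE//; lra.
  have K0 : 0 <= (s + h) `^ (- b) / (s + h) by rewrite divr_ge0 ?powR_ge0// ltW.
  rewrite -!mulrA ler_pM2l// !mulrA.
  have A : t - s <= `|s - t| by rewrite distrC ler_norm.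
  apply: (@le_trans _ _ ((s + h) `^ (- b) / (s + h) * `|s - t|)).
    exact: ler_wpM2l.
  exact: ler_wpM2r.
rewrite ler_norml; apply/andP; split.
  rewrite lerNl opprB [`|_|]distrC; apply: aux; exact: sqdist_ge0.
by apply: aux; exact: sqdist_ge0.
Qed.

Lemma kreg_unif_cont b h (L d : R) : 0 < b -> 0 < h -> 0 < d ->
  exists2 r : R, 0 < r & forall x x' y y' : 'rV[R]_n,
  box L x -> box L x' -> box L y -> box L y' ->
  (forall i, `|x 0 i - x' 0 i| <= r) -> (forall i, `|y 0 i - y' 0 i| <= r) ->
  `|kreg b h x y - kreg b h x' y'| <= d.
Proof.
move=> b0 h0 d0; pose K := b * h `^ (- b) / h.
have K0 : 0 < K by rewrite divr_gt0// mulr_gt0// powR_gt0.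
have LL : 0 <= n%:R * (8 * `|L|) by rewrite !mulr_ge0.
pose D := K * (n%:R * (8 * `|L|)) + 1.
have D0 : 0 < D by rewrite ltr_wpDl// mulr_ge0// ltW.
exists (d / D) => [|x x' y y' xL x'L yL y'L xr yr]; first exact: divr_gt0.
have r0 : 0 <= d / D by rewrite divr_ge0// ltW.
apply: le_trans (kreg_lip _ _ _ _ b0 h0) _; rewrite -/K.
have LE i : `|x 0 i| <= L -> L = `|L|.
  by move=> xiL; rewrite ger0_norm//; apply: le_trans xiL.
have H := sqdist_lip xL x'L yL y'L xr yr.
apply: le_trans (ler_wpM2l (ltW K0) H) _.
apply: (@le_trans _ _ (K * (n%:R * (8 * `|L| * (d / D))))).
  rewrite ler_pM2l//; apply: ler_wpM2l => //; rewrite ler_wpM2r//.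
  by rewrite ler_pM2l// ler_norm.
have -> : K * (n%:R * (8 * `|L| * (d / D))) = d * ((D - 1) / D).
  by rewrite /D; field; rewrite gt_eqF.
by rewrite ler_piMr ?(ltW d0)// ler_pdivrMr// mul1r gerBl.
Qed.

End Kernel.

(** * Borel sets and compact sets of R^n *)

Section Borel.
Context (R : realType) (n : nat).
Implicit Types (x y z : 'rV[R]_n) (b h c : R).

Lemma open_measurable_rV (U : set 'rV[R]_n) :
  open U -> measurable (U : set (borelRn R n)).
Proof. exact: sub_gen_smallest. Qed.

Lemma closed_measurable_rV (U : set 'rV[R]_n) :
  closed U -> measurable (U : set (borelRn R n)).
Proof.
move=> cU; rewrite -[U]setCK; apply: measurableC.
by apply: open_measurable_rV; rewrite openC.
Qed.

Lemma compact_measurable_rV (U : set 'rV[R]_n) :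
  compact U -> measurable (U : set (borelRn R n)).
Proof.
by move=> cU; apply: closed_measurable_rV; apply: compact_closed => //; exact: norm_hausdorff.
Qed.

Lemma continuous_measurable_rV (f : 'rV[R]_n -> R) :
  continuous f -> measurable_fun (setT : set (borelRn R n)) f.
Proof.
move=> /continuousP cf; apply: (measurability _ (RGenOpens.measurableE R)).
move=> _ [_ [a [b ->] <-]]; rewrite setTI; apply: open_measurable_rV.
exact/cf/interval_open.
Qed.

Lemma measurable_sqdist :
  measurable_fun setT (fun z : borelRn R n * borelRn R n => sqdist z.1 z.2).
Proof.
apply: measurable_sum => i; apply: measurable_funX; apply: measurable_funB.
- apply: (@measurableT_comp _ _ _ _ _ _ (fun x : borelRn R n => (x : 'rV[R]_n) 0 i)).
    by apply: continuous_measurable_rV; exact: coord_continuous.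
  exact: measurable_fst.
- apply: (@measurableT_comp _ _ _ _ _ _ (fun x : borelRn R n => (x : 'rV[R]_n) 0 i)).
    by apply: continuous_measurable_rV; exact: coord_continuous.
  exact: measurable_snd.
Qed.

Lemma measurable_kreg b h :
  measurable_fun setT (fun z : borelRn R n * borelRn R n => kreg b h z.1 z.2).
Proof.
apply: (@measurableT_comp _ _ _ _ _ _ (@powR R ^~ (- b))); first exact: measurable_powR.
by apply: measurable_funD => //; exact: measurable_sqdist.
Qed.

Lemma measurable_diag_if (f : R -> R) : measurable_fun setT f ->
  measurable_fun setT (fun z : borelRn R n * borelRn R n =>
    if (z.1 : 'rV[R]_n) == z.2 then +oo%E else (f (sqdist z.1 z.2))%:E).
Proof.
move=> mf; under eq_fun do rewrite -sqdist_eq0.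
apply: measurable_fun_ifT => //.
  by apply: measurable_fun_eqr => //; exact: measurable_sqdist.
by apply/measurable_EFinP; apply: measurableT_comp => //; exact: measurable_sqdist.
Qed.

Lemma measurable_kern b :
  measurable_fun setT (fun z : borelRn R n * borelRn R n => kern b z.1 z.2).
Proof. by apply: (@measurable_diag_if (fun s => s `^ (- b))); exact: measurable_powR. Qed.

Lemma measurable_kdiff b h :
  measurable_fun setT (fun z : borelRn R n * borelRn R n => kdiff b h z.1 z.2).
Proof.
apply: (@measurable_diag_if (fun s => s `^ (- b) - (s + h) `^ (- b))).
apply: measurable_funB; first exact: measurable_powR.
apply: (@measurableT_comp _ _ _ _ _ _ (@powR R ^~ (- b))); first exact: measurable_powR.
exact: measurable_funD.
Qed.

Lemma compact_box (L : R) : compact (@box R n L).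
Proof.
have := @rV_compact R n (fun=> `[- L, L]%classic) (fun=> @segment_compact _ _ _).
congr compact; apply/seteqP; split => v vL i; have := vL i;
  by rewrite /= in_itv/= ler_norml.
Qed.

Lemma compact_sub_box (K : set 'rV[R]_n) : compact K ->
  exists2 L : R, 0 < L & K `<=` box L.
Proof.
move=> /compact_bounded/ex_strict_bound_gt0[L L0 KL]; exists L => // v Kv i.
apply: le_trans (ltW (KL v Kv)).
by rewrite [leRHS]/Num.norm/= mx_normrE; apply/bigmax_geP; right => /=; exists (0, i).
Qed.

Lemma box_cover : \bigcup_(k : nat) @box R n k%:R = setT.
Proof.
apply/seteqP; split => // v _.
have [L L0 vL] := compact_sub_box (@compact_set1 _ v).
exists (Num.bound L) => // i; apply: le_trans (vL v erefl i) _.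
by apply: ltW; apply: archi_boundP; exact: ltW.
Qed.

Lemma radon_sigma_finite (mu : {measure set (borelRn R n) -> \bar R}) :
  radon mu -> sigma_finite setT mu.
Proof.
move=> [mu1 _]; exists (fun k => box k%:R); first by rewrite box_cover.
move=> k; split; last by apply: mu1; exact: compact_box.
by apply: compact_measurable_rV; exact: compact_box.
Qed.

Lemma continuous_sum_fun (T : topologicalType) (I : Type) (r : seq I) (F : I -> T -> R) :
  (forall i, continuous (F i)) -> continuous (fun t => \sum_(i <- r) F i t).
Proof.
move=> cF; elim: r => [|i r IH] x.
  rewrite (_ : (fun _ => _) = cst 0); first exact: cst_continuous.
  by apply/funext => ?; rewrite big_nil.
rewrite (_ : (fun _ => _) = F i \+ (fun u => \sum_(j <- r) F j u)); last first.
  by apply/funext => ?; rewrite big_cons.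
by apply: continuousD; [exact: cF | exact: IH].
Qed.

Lemma continuous_sqdist y : continuous (fun x => sqdist x y).
Proof.
apply: continuous_sum_fun => i x.
apply: (@continuous_comp _ _ _ (fun x : 'rV[R]_n => x 0 i - y 0 i)
  (fun t : R => t ^+ 2)); last exact: exprn_continuous.
apply: (@continuousB _ _ _ (fun x : 'rV[R]_n => x 0 i) (cst (y 0 i))).
  exact: coord_continuous.
exact: cst_continuous.
Qed.

(** Take a point of D nearest to x: the triangle inequality at most doubles the
    distance to the points of D, hence the factor 4 between squares. *)
Lemma exists_nearest (D : set 'rV[R]_n) x : compact D -> D !=set0 ->
  exists2 x', D x' & forall y, D y -> sqdist x' y <= 4 * sqdist x y.
Proof.
move=> cD D0.
have [|x' x'D H] := @EVT_min_rV R n (fun y => sqdist y x) D D0 cD.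
  by apply: continuous_subspaceT; exact: continuous_sqdist.
exists x'; first exact/set_mem.
move=> y Dy; have := H y (mem_set Dy); have := sqdist_triangle x' x y.
by rewrite (sqdistC y x); lra.
Qed.

End Borel.

(** * Potentials of measures with densities *)

Section Potential.
Context (R : realType) (n : nat).
Implicit Types (x y z : 'rV[R]_n) (k : 'rV[R]_n -> 'rV[R]_n -> \bar R).
Implicit Types (mu nu : {measure set (borelRn R n) -> \bar R}).
Implicit Types (f g : 'rV[R]_n -> R).

Definition mfun_ge0 f :=
  measurable_fun (setT : set (borelRn R n)) f /\ forall y, 0 <= f y.

Definition kernel_ge0 k :=
  measurable_fun setT (fun z : borelRn R n * borelRn R n => k z.1 z.2) /\
  forall x y, (0 <= k x y)%E.

(** The potential of the measure [f mu]. *)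
Definition pot k mu f x : \bar R := (\int[mu]_y (k x y * (f y)%:E))%E.

(** The potential of mu restricted to B is the uniform limit of its
    regularisations; this makes the potentials of all bounded densities on B
    continuous. *)
Definition uniformly_regularizable b mu (B : set 'rV[R]_n) :=
  forall d : R, 0 < d -> exists2 h : R, 0 < h <= 1 &
    forall x, (pot (kdiff b h) mu (\1_B) x <= d%:E)%E.

Lemma mfun_ge0_cst (c : R) : 0 <= c -> mfun_ge0 (fun=> c).
Proof. by move=> c0; split => //; exact: measurable_cst. Qed.

Lemma mfun_ge0_indic (D : set 'rV[R]_n) :
  measurable (D : set (borelRn R n)) -> mfun_ge0 (\1_D).
Proof. by move=> mD; split. Qed.

Lemma kernel_ge0_kern b : kernel_ge0 (kern b).
Proof. by split => [|x y]; [exact: measurable_kern | exact: kern_ge0]. Qed.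

Lemma kernel_ge0_kreg b h : kernel_ge0 (fun x y => (kreg b h x y)%:E).
Proof.
split => [|x y]; last by rewrite lee_fin kreg_ge0.
by apply/measurable_EFinP; exact: measurable_kreg.
Qed.

Lemma kernel_ge0_kdiff b h : 0 < b -> 0 <= h -> kernel_ge0 (kdiff b h).
Proof. by move=> b0 h0; split => [|x y]; [exact: measurable_kdiff | exact: kdiff_ge0]. Qed.

Lemma integrand_measurable k f x : kernel_ge0 k -> mfun_ge0 f ->
  measurable_fun (setT : set (borelRn R n)) (fun y => k x y * (f y)%:E)%E.
Proof.
move=> [mk _] [mf _]; apply: emeasurable_funM; last exact/measurable_EFinP.
exact: (@measurable_fun_pair2 _ _ _ _ _ _ _ (x : borelRn R n) mk).
Qed.

Lemma integrand_ge0 k f x y : kernel_ge0 k -> mfun_ge0 f ->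
  (0 <= k x y * (f y)%:E)%E.
Proof. by move=> [_ k0] [_ f0]; rewrite mule_ge0// lee_fin. Qed.

Lemma pot_ge0 k mu f x : kernel_ge0 k -> mfun_ge0 f -> (0 <= pot k mu f x)%E.
Proof. by move=> kP fP; apply: integral_ge0 => y _; exact: integrand_ge0. Qed.

Lemma pot_le k k' mu f f' x x' : kernel_ge0 k -> kernel_ge0 k' ->
  mfun_ge0 f -> mfun_ge0 f' ->
  (forall y, k x y * (f y)%:E <= k' x' y * (f' y)%:E)%E ->
  (pot k mu f x <= pot k' mu f' x')%E.
Proof.
move=> kP k'P fP f'P le; apply: ge0_le_integral => //.
- by move=> y _; exact: integrand_ge0.
- exact: integrand_measurable.
- exact: integrand_measurable.
Qed.

Lemma pot_leZ k k' mu f f' x x' (c : R) : 0 <= c -> kernel_ge0 k -> kernel_ge0 k' ->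
  mfun_ge0 f -> mfun_ge0 f' ->
  (forall y, k x y * (f y)%:E <= c%:E * (k' x' y * (f' y)%:E))%E ->
  (pot k mu f x <= c%:E * pot k' mu f' x')%E.
Proof.
move=> c0 kP k'P fP f'P le; rewrite /pot -ge0_integralZl_EFin//; first last.
- exact: integrand_measurable.
- by move=> y _; exact: integrand_ge0.
apply: ge0_le_integral => //.
- by move=> y _; exact: integrand_ge0.
- exact: integrand_measurable.
- by apply: emeasurable_funM; [exact: measurable_cst | exact: integrand_measurable].
Qed.

Lemma pot_split b h mu f x : 0 < b -> 0 <= h -> mfun_ge0 f ->
  pot (kern b) mu f x =
  (pot (kdiff b h) mu f x + pot (fun x y => (kreg b h x y)%:E) mu f x)%E.
Proof.
move=> b0 h0 fP; have dP := kernel_ge0_kdiff b0 h0; have rP := kernel_ge0_kreg b h.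
rewrite /pot -ge0_integralD//.
- by apply: eq_integral => y _; rewrite -ge0_muleDl ?lee_fin ?kreg_ge0
    ?kdiff_ge0// -kern_split.
- by move=> y _; exact: (integrand_ge0 x y dP fP).
- exact: (integrand_measurable x dP fP).
- by move=> y _; exact: (integrand_ge0 x y rP fP).
- exact: (integrand_measurable x rP fP).
Qed.

(** A crude maximum principle, which loses a constant factor: replace x by a
    nearest point of D, which at most doubles its distance to the points charged
    by [f mu]. *)
Lemma pot_le_on_support k k' mu f (D : set 'rV[R]_n) (c C : R) :
  0 <= c -> 0 <= C -> kernel_ge0 k -> kernel_ge0 k' -> mfun_ge0 f -> compact D ->
  (forall y, ~ D y -> f y = 0) ->
  (forall x x' y, sqdist x' y <= 4 * sqdist x y -> (k x y <= c%:E * k' x' y)%E) ->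
  (forall x, D x -> pot k' mu f x <= C%:E)%E ->
  forall x, (pot k mu f x <= (c * C)%:E)%E.
Proof.
move=> c0 C0 kP k'P fP cD fD kk' DC x.
have [D0|D0] := eqVneq D set0.
  rewrite /pot integral0_eq ?lee_fin ?mulr_ge0// => y _.
  by rewrite fD ?mule0// D0.
have [x' Dx' Hx'] := exists_nearest x cD ((set0P D).1 D0).
apply: (@le_trans _ _ (c%:E * pot k' mu f x')%E).
  apply: pot_leZ => // y; have [Dy|Dy] := pselect (D y); last by rewrite fD// !mule0.
  rewrite muleA; apply: lee_wpmul2r; first by rewrite lee_fin; have [_] := fP.
  by apply: kk'; exact: Hx'.
by rewrite EFinM lee_wpmul2l ?lee_fin// DC.
Qed.

Lemma pot_measurable k mu f : radon mu -> kernel_ge0 k -> mfun_ge0 f ->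
  measurable_fun (setT : set (borelRn R n)) (pot k mu f).
Proof.
move=> /radon_sigma_finite hmu kP fP.
have := @tonelli_measurable _ _ _ _ _ mu hmu
  (fun z : borelRn R n * borelRn R n => k z.1 z.2 * (f z.2)%:E)%E.
apply.
- apply: emeasurable_funM; first by have [] := kP.
  apply/measurable_EFinP; apply: (@measurableT_comp _ _ _ _ _ _ (f : borelRn R n -> R)).
    by have [] := fP.
  exact: measurable_snd.
- by move=> z; exact: integrand_ge0.
Qed.

(** Reciprocity of mutual energies: Tonelli and the symmetry of the kernel. *)
Lemma pot_exchange k mu nu f g : radon mu -> radon nu ->
  (forall x y, k x y = k y x) -> kernel_ge0 k -> mfun_ge0 f -> mfun_ge0 g ->
  (\int[nu]_x (pot k mu f x * (g x)%:E) = \int[mu]_y (pot k nu g y * (f y)%:E))%E.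
Proof.
move=> /radon_sigma_finite hmu /radon_sigma_finite hnu kC kP fP gP.
have H := @tonelli _ _ _ _ _ nu mu hnu hmu
  (fun z : borelRn R n * borelRn R n => k z.1 z.2 * (f z.2)%:E * (g z.1)%:E)%E.
rewrite /pot.
transitivity (\int[nu]_x \int[mu]_y (k x y * (f y)%:E * (g x)%:E))%E.
  apply: eq_integral => x _; rewrite ge0_integralZr ?lee_fin//.
  - exact: integrand_measurable.
  - by move=> y _; exact: integrand_ge0.
  - by have [_] := gP.
rewrite H.
- apply: eq_integral => y _.
  under eq_integral do rewrite /= kC -muleA (muleC (f y)%:E) muleA.
  rewrite ge0_integralZr ?lee_fin//.
  - exact: integrand_measurable.
  - by move=> x _; exact: integrand_ge0.
  - by have [_] := fP.
- apply: emeasurable_funM; [apply: emeasurable_funM|]; first by have [] := kP.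
    apply/measurable_EFinP; apply: (@measurableT_comp _ _ _ _ _ _ (f : borelRn R n -> R)).
      by have [] := fP.
    exact: measurable_snd.
  apply/measurable_EFinP; apply: (@measurableT_comp _ _ _ _ _ _ (g : borelRn R n -> R)).
    by have [] := gP.
  exact: measurable_fst.
- move=> z; rewrite mule_ge0//; first exact: integrand_ge0.
  by rewrite lee_fin; have [_] := gP.
Qed.

Lemma riesz_potentialE (alpha : R) mu :
  riesz_potential alpha mu = pot (kern ((n%:R - alpha) / 2)) mu (fun=> 1).
Proof. by apply/funext => x; apply: eq_integral => y _; rewrite mule1 riesz_kernelE. Qed.

Lemma riesz_energyE (alpha : R) mu : radon mu ->
  (riesz_energy alpha mu = \int[mu]_x riesz_potential alpha mu x)%E.
Proof.
move=> /radon_sigma_finite hmu.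
pose F (z : borelRn R n * borelRn R n) : \bar R := kern ((n%:R - alpha) / 2) z.1 z.2.
have FE : (fun z : borelRn R n * borelRn R n =>
    riesz_kernel alpha (z.1 : 'rV[R]_n) z.2) = F.
  by apply/funext => z; rewrite riesz_kernelE.
have F0 (u : borelRn R n * borelRn R n) : (0 <= F u)%E by exact: kern_ge0.
have H := tonelli_prod hmu hmu
  (measurable_kern ((n%:R - alpha) / 2) : measurable_fun setT F) F0.
rewrite /riesz_energy FE H; apply: eq_integral => x _.
by apply: eq_integral => y _; rewrite riesz_kernelE.
Qed.

End Potential.

(** * Sets of inner capacity zero *)

Section Capacity.
Context (R : realType) (n : nat).
Implicit Types (x y z : 'rV[R]_n) (K D S : set 'rV[R]_n).
Implicit Types (mu nu : {measure set (borelRn R n) -> \bar R}).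

(** The infimum that defines the capacity can be infinite only over the empty
    family, since all its competitors have finite energy. *)
Lemma inner_capacity_eq0 (alpha : R) (A : set 'rV[R]_n) :
  inner_capacity alpha A = 0%E <->
  (forall lam : {measure set (borelRn R n) -> \bar R},
     finite_energy_on alpha A lam -> lam setT = 1%E -> False).
Proof.
rewrite /inner_capacity; split => [/eqP|noM].
  rewrite inve_eq0 => /eqP H lam lamE lam1.
  have : (ereal_inf [set riesz_energy alpha mu | mu in
     [set mu | finite_energy_on alpha A mu /\ mu [set: borelRn R n] = 1%E]]
     <= riesz_energy alpha lam)%E.
    by apply: ereal_inf_lbound; exists lam.
  by rewrite H leye_eq => /eqP E; have [_ lamF] := lamE; rewrite E ltxx in lamF.
apply/eqP; rewrite inve_eq0; apply/eqP; rewrite -(ereal_inf0 R); congr ereal_inf.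
by apply/seteqP; split => // t [lam [lamE lam1] _]; case: (noM lam lamE lam1).
Qed.

Lemma inner_capacity0_sub (alpha : R) (A B : set 'rV[R]_n) : A `<=` B ->
  inner_capacity alpha B = 0%E -> inner_capacity alpha A = 0%E.
Proof.
move=> AB /inner_capacity_eq0 H; apply/inner_capacity_eq0 => lam [[lamP lamA] lamE].
apply: H; split => //; split => //; apply: negligibleS lamA.
exact: subsetC.
Qed.

(** Inner regularity reduces nullity to compact subsets, which is all that
    absolute continuity with respect to capacity controls. *)
Lemma radon_null mu S : radon mu -> measurable (S : set (borelRn R n)) ->
  (forall K, compact K -> K `<=` S -> mu K = 0%E) -> mu S = 0%E.
Proof.
move=> [_ reg] mS K0; rewrite reg//; apply/eqP; rewrite eq_le; apply/andP; split.
  by apply: ge_ereal_sup => _ [K [cK KS] <-]; rewrite K0.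
by apply: ereal_sup_ubound; exists set0 => //; split => //; exact: compact0.
Qed.

Lemma radon_compact_gt mu S (a : \bar R) : radon mu -> measurable (S : set (borelRn R n)) ->
  (a < mu S)%E -> exists K, [/\ compact K, K `<=` S & (a < mu K)%E].
Proof.
move=> [_ reg] mS; rewrite reg// => /ereal_sup_gt[_ [K [cK KS] <-] aK].
by exists K.
Qed.

Lemma capacity_ac_null (alpha : R) mu S :
  radon mu -> capacity_absolutely_continuous alpha mu ->
  measurable (S : set (borelRn R n)) ->
  (forall K, compact K -> K `<=` S -> inner_capacity alpha K = 0%E) -> mu S = 0%E.
Proof.
by move=> rmu ac mS HS; apply: radon_null => // K cK KS; apply: ac => //; exact: HS.
Qed.

Lemma concentrated_setC mu K : measurable (K : set (borelRn R n)) ->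
  concentrated mu K -> mu (~` K) = 0%E.
Proof. by move=> mK H; apply: measure_negligible H; exact: measurableC. Qed.

(** K is covered up to a null set by the countably many sets where the potential
    is at most k, so one of these has positive measure; inner regularity then
    gives a compact subset. *)
Lemma exists_bounded_potential_piece b mu K :
  0 < b -> radon mu -> measurable (K : set (borelRn R n)) ->
  (0 < mu K)%E -> {ae mu, forall x, (pot (kern b) mu (fun=> 1%R) x < +oo)%E} ->
  exists D (C : R), [/\ compact D, D `<=` K, (0 < mu D)%E, 0 <= C &
     forall x, D x -> (pot (kern b) mu (fun=> 1%R) x <= C%:E)%E].
Proof.
move=> b0 rmu mK muK ae.
have kP := @kernel_ge0_kern R n b; have oneP := @mfun_ge0_cst R n 1 ler01.
have mP := pot_measurable rmu kP oneP.
pose S (k : nat) := K `&` [set x | (pot (kern b) mu (fun=> 1%R) x <= k%:R%:E)%E].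
have mS k : measurable (S k : set (borelRn R n)).
  apply: measurableI => //; rewrite -[X in measurable X]setTI.
  exact: emeasurable_fun_infty_c.
have [k muSk] : exists k, (0 < mu (S k))%E.
  apply: contrapT => /forallNP H.
  have S0 k : mu.-negligible (S k).
    apply/negligibleP => //; apply/eqP; rewrite eq_le measure_ge0 andbT leNgt.
    by apply/negP; exact: H.
  move: muK; rewrite lt_def => /andP[/eqP + _]; apply.
  apply/negligibleP => //.
  apply: negligibleS (negligibleU (negligible_bigcup S0) ae) => x Kx.
  have [fx|fx] := pselect (pot (kern b) mu (fun=> 1%R) x < +oo)%E; last by right.
  left; have f0 := pot_ge0 mu x kP oneP.
  move: fx f0; rewrite /S; case E : (pot _ _ _ _) => [r| |]// _ r0.
  exists (Num.bound r) => //; split => //=; rewrite E lee_fin ltW//.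
  exact: archi_boundP.
have [D [cD DS muD]] := radon_compact_gt rmu (mS k) muSk.
exists D, k%:R; split => //; first by move=> x /DS[].
by move=> x /DS[].
Qed.

(** Suppose that K carries a unit measure lam of finite energy.  Some compact
    part D of K has positive lam-measure and bounded lam-potential, so that the
    potential of lam restricted to D is bounded everywhere, and at infinity
    it is dominated by the kernel with pole at [x0], a point where the potential
    of mu is finite.  It is therefore mu-integrable.  By reciprocity, its integral
    is that of the potential of mu over D, which is infinite. *)
Lemma polar_infinity (alpha : R) mu K : alpha < n%:R -> compact K ->
  radon_finite_potential alpha mu ->
  (forall x, K x -> riesz_potential alpha mu x = +oo%E) ->
  inner_capacity alpha K = 0%E.
Proof.
move=> an cK [rmu [x0 mux0]] Koo; apply/inner_capacity_eq0 => lam [[[rlam _] lamK] lamE] lam1.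
pose b := (n%:R - alpha) / 2; have b0 : 0 < b by rewrite divr_gt0// subr_gt0.
have kP := @kernel_ge0_kern R n b; have oneP := @mfun_ge0_cst R n 1 ler01.
have mK := compact_measurable_rV cK.
have lamKgt0 : (0 < lam K)%E.
  rewrite lt_def measure_ge0 andbT; apply/eqP => lamK0.
  have : (lam [set: borelRn R n] <= lam K + lam (~` K))%E.
    by rewrite -(setUv K) measureU2//; exact: measurableC.
  by rewrite lam1 lamK0 concentrated_setC// adde0 lee_fin ler10.
have ae : {ae lam, forall x, (pot (kern b) lam (fun=> 1%R) x < +oo)%E}.
  have I : lam.-integrable setT (pot (kern b) lam (fun=> 1%R)).
    apply/integrableP; split; first exact: pot_measurable.
    under eq_integral do rewrite gee0_abs ?pot_ge0//.
    move: lamE; rewrite (riesz_energyE alpha rlam).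
    by rewrite riesz_potentialE.
  apply: filterS (integrable_ae measurableT I) => x /(_ Logic.I).
  by rewrite ge0_fin_numE// pot_ge0.
have [D [C [cD DK lamD C0 DC]]] :=
  exists_bounded_potential_piece b0 rlam mK lamKgt0 ae.
have mD := compact_measurable_rV cD; have DP := mfun_ge0_indic mD.
have D01 y : (\1_D y : R) <= 1 by rewrite indicE; case: (_ \in _).
pose c := 4^-1 `^ (- b) : R; have c0 : 0 <= c by exact: powR_ge0.
have bound y : (pot (kern b) lam (\1_D) y <= (c * C)%:E)%E.
  apply: (pot_le_on_support (k' := kern b)) cD _ _ _ y => //.
  - by move=> y Dy; rewrite indicE memNset.
  - by move=> x x' y H; apply: kern_le_dilate => //; rewrite invrK.
  - move=> x Dx; apply: le_trans (DC x Dx); apply: pot_le => // y.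
    by rewrite lee_wpmul2l ?kern_ge0// lee_fin.
have [L L0 DL] := compact_sub_box cD.
pose L' := Num.max L (1 + \sum_i `|x0 0 i|); have L'0 : 0 < L'.
  by rewrite lt_max L0.
pose M := n%:R * (2 * L') ^+ 2.
have M0 : 0 <= M by rewrite mulr_ge0// sqr_ge0.
have x0L i : `|x0 0 i| <= L'.
  rewrite le_max; apply/orP; right; rewrite (bigD1 i)//= addrCA lerDl.
  by rewrite addr_ge0// sumr_ge0.
have zL z i : D z -> `|z 0 i| <= L' by move=> Dz; rewrite le_max DL.
have x0D z : D z -> sqdist x0 z <= M.
  move=> Dz; rewrite /M mulr_natl -[in leRHS](card_ord n) -sumr_const ler_sum// => i _.
  rewrite -[leLHS]ger0_norm ?sqr_ge0// normrX lerXn2r ?nnegrE ?mulr_ge0 ?(ltW L'0)//.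
  by apply: le_trans (ler_normB _ _) _; have := x0L i; have := zL _ i Dz; lra.
pose c' := 2 + 2 * M; have c'0 : 0 < c' by rewrite /c'; lra.
pose c'' := c'^-1 `^ (- b); have c''0 : 0 <= c'' by exact: powR_ge0.
have far y : ~ box (L' + 1) y -> (pot (kern b) lam (\1_D) y <= c''%:E * kern b x0 y)%E.
  move=> /existsNP[i /negP]; rewrite -ltNge => yi.
  apply: (@le_trans _ _ (\int[lam]_z (c''%:E * kern b x0 y * (\1_D z)%:E))%E).
    apply: ge0_le_integral => //.
    - by move=> z _; exact: integrand_ge0.
    - exact: integrand_measurable.
    - by apply: emeasurable_funM => //; exact/measurable_EFinP.
    move=> z _; have [Dz|Dz] := pselect (D z); last by rewrite indicE memNset// !mule0.
    apply: lee_wpmul2r; first by rewrite lee_fin.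
    rewrite kernC; apply: kern_le_dilate => //.
    have := sqdist_triangle x0 z y; have := x0D z Dz.
    have : 1 <= sqdist z y.
      apply: le_trans (sqdist_coord z y i).
      rewrite -[leRHS]ger0_norm ?sqr_ge0// normrX expr_ge1//.
      by rewrite distrC; have := lerB_dist (y 0 i) (z 0 i); have := zL _ i Dz; lra.
    rewrite /c'; move: M0; set q := sqdist z y; set q' := sqdist x0 z.
    by set q2 := sqdist x0 y; nra.
  rewrite ge0_integralZl//; last 2 first.
  - exact/measurable_EFinP.
  - by rewrite mule_ge0// kern_ge0.
  rewrite integral_indic// setIT -[leRHS]mule1; apply: lee_wpmul2l.
    by rewrite mule_ge0// kern_ge0.
  by rewrite -lam1; apply: le_measure; rewrite ?inE//.
suff : (\int[mu]_y (pot (kern b) lam (\1_D) y * 1%:E) < +oo)%E.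
  rewrite pot_exchange//; last exact: kernC.
  rewrite [X in (X < _)%E](_ : _ = \int[lam]_x (+oo * (\1_D x)%:E))%E; last first.
    apply: eq_integral => x _; have [Dx|Dx] := pselect (D x); last first.
      by rewrite indicE memNset// !mule0.
    by rewrite -(Koo x (DK x Dx)) riesz_potentialE.
  rewrite ge0_integralZl//; last exact/measurable_EFinP.
  by rewrite integral_indic// setIT gt0_mulye ?ltxx.
have mBox := compact_measurable_rV (@compact_box R n (L' + 1)).
apply: (@le_lt_trans _ _ (\int[mu]_y ((c * C)%:E * (\1_(box (L' + 1)) y)%:E
   + c''%:E * (kern b x0 y * 1%:E)))%E).
  apply: ge0_le_integral => //.
  - by move=> y _; rewrite mule1 pot_ge0.
  - by under eq_fun do rewrite mule1; exact: pot_measurable.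
  - apply: emeasurable_funD; apply: emeasurable_funM => //.
      exact/measurable_EFinP.
    exact: integrand_measurable.
  move=> y _; rewrite !mule1; have [By|By] := pselect (box (L' + 1) y).
    rewrite indicE mem_set// mule1; apply: le_trans (bound y) _.
    by rewrite leeDl// mule_ge0// kern_ge0.
  by rewrite indicE memNset// mule0 add0e; exact: far.
have cC0 : 0 <= c * C by rewrite mulr_ge0.
rewrite ge0_integralD//; last 4 first.
- by move=> y _; rewrite mule_ge0// lee_fin.
- by apply: emeasurable_funM => //; exact/measurable_EFinP.
- by move=> y _; rewrite mule_ge0// integrand_ge0.
- by apply: emeasurable_funM => //; exact: integrand_measurable.
rewrite !ge0_integralZl_EFin//; last 3 first.
- by move=> y _; exact: (@integrand_ge0 _ _ _ _ x0 y kP oneP).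
- exact: (@integrand_measurable _ _ _ _ x0 kP oneP).
- exact/measurable_EFinP.
rewrite integral_indic// setIT lte_add_pinfty//.
  by apply: lte_mul_pinfty => //; have [H _] := rmu; apply: H; exact: compact_box.
apply: lte_mul_pinfty => //.
rewrite -/(pot (kern b) mu (fun=> 1%R) x0) -riesz_potentialE.
by rewrite ltey; apply/eqP.
Qed.

End Capacity.

(** * Uniform convergence of the regularised potentials *)

Section Egorov.
Context (R : realType) (n : nat).
Implicit Types (x y z : 'rV[R]_n) (K D S : set 'rV[R]_n).
Implicit Types (mu nu : {measure set (borelRn R n) -> \bar R}).

Lemma kdiff_cvg0 b x y : 0 < b -> x != y ->
  kdiff b k.+1%:R^-1 x y @[k --> \oo] --> (0 : \bar R)%E.
Proof.
move=> b0 xy; have s0 := sqdist_gt0 xy; set s := sqdist x y in s0.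
pose c := b * s `^ (- b) / s.
have c0 : 0 <= c by rewrite divr_ge0 ?ltW// mulr_gt0// powR_gt0.
rewrite /kdiff (negbTE xy); apply: cvg_EFin; first by near=> k.
rewrite /comp /=.
have H : (fun k : nat => c * k.+1%:R^-1) @ \oo --> (0 : R).
  rewrite -(mulr0 c); apply: cvgMr; exact: cvg_harmonic.
apply: (squeeze_cvgr _ (cvg_cst 0) H).
near=> k; have k0 : 0 < k.+1%:R^-1 :> R by rewrite invr_gt0.
move: k0; set t := k.+1%:R^-1 => t0; have st : 0 < s + t by exact: addr_gt0.
apply/andP; split.
  by rewrite subr_ge0; apply: powRN_le => //; rewrite lerDl ltW.
have := powRN_tangent b0 s0 st; rewrite [s + t]addrC addrK [t + s]addrC.
by rewrite /kreg -/s -/c => H'; rewrite lerBlDl -lerBlDr.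
Unshelve. all: by end_near.
Qed.

Lemma pot_kdiff_cvg0 b mu f x : 0 < b -> mfun_ge0 f ->
  (pot (kern b) mu f x < +oo)%E ->
  pot (kdiff b k.+1%:R^-1) mu f x @[k --> \oo] --> (0 : \bar R)%E.
Proof.
move=> b0 fP foo.
have kP := @kernel_ge0_kern R n b.
have h0 k : 0 <= k.+1%:R^-1 :> R by rewrite invr_ge0.
have dP k := @kernel_ge0_kdiff R n b k.+1%:R^-1 b0 (h0 k).
pose g (y : borelRn R n) := (kern b x y * (f y)%:E)%E.
have g0 y : (0 <= g y)%E by exact: integrand_ge0.
have gI : mu.-integrable setT g.
  apply/integrableP; split; first exact: integrand_measurable.
  by under eq_integral do rewrite gee0_abs//.
have := @dominated_convergence _ _ _ mu setT measurableT
  (fun k y => kdiff b k.+1%:R^-1 x y * (f y)%:E)%E (cst 0%E) g.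
case=> //.
- by move=> k; exact: integrand_measurable.
- apply: filterS (integrable_ae measurableT gI) => y /(_ Logic.I) gy _.
  have [fy0|fy0] := eqVneq (f y) 0.
    by rewrite fy0; under eq_fun do rewrite mule0; exact: cvg_cst.
  have xy : x != y.
    apply: contraTneq gy => xy; rewrite /g /kern xy eqxx gt0_mulye//.
    by rewrite lte_fin lt_def fy0 (proj2 fP).
  rewrite -(mul0e (f y)%:E); apply: cvgeZr => //; exact: kdiff_cvg0.
- apply: aeW => y k _; rewrite gee0_abs ?integrand_ge0//.
  apply: lee_wpmul2r; first by rewrite lee_fin; have [_] := fP.
  by rewrite (kern_split b k.+1%:R^-1) leeDl// lee_fin kreg_ge0.
by move=> _ _; rewrite integral0.
Qed.

(** Off the null set where the potential is infinite, the potentials of the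
    remainders [kdiff] decrease to 0 pointwise.  Egorov's theorem makes the
    convergence uniform on a large part of K, inner regularity makes that part
    compact, and the crude maximum principle extends the bound to the whole
    space. *)
Lemma exists_uniform_piece b mu K (e : R) : 0 < b -> radon mu -> compact K ->
  mu [set x | pot (kern b) mu (fun=> 1) x = +oo%E] = 0%E -> 0 < e ->
  exists B, [/\ compact B, B `<=` K, (mu K <= mu B + e%:E)%E &
    uniformly_regularizable b mu B].
Proof.
move=> b0 rmu cK mu0 e0.
have kP := @kernel_ge0_kern R n b; have oneP := @mfun_ge0_cst R n 1 ler01.
have h0 k : 0 <= k.+1%:R^-1 :> R by rewrite invr_ge0.
have dP k := @kernel_ge0_kdiff R n b k.+1%:R^-1 b0 (h0 k).
have mK := compact_measurable_rV cK; have KP := mfun_ge0_indic mK.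
have I1 D y : (\1_D y : R) <= 1 by rewrite indicE; case: (_ \in _).
have mP := pot_measurable rmu kP oneP.
pose Soo := [set x | pot (kern b) mu (fun=> 1) x = +oo%E].
have mSoo : measurable (Soo : set (borelRn R n)).
  rewrite -[X in measurable X]setTI; exact: (mP measurableT _ (emeasurable_set1 +oo%E)).
pose A : set (borelRn R n) := K `\` Soo; have mA : measurable A by exact: measurableD.
have muA : mu A = mu K.
  rewrite (measureDI _ mK mSoo) -/A (@subset_measure0 _ _ _ mu (K `&` Soo) Soo) ?adde0//.
  exact: measurableI.
have muKoo : (mu K < +oo)%E by have [H _] := rmu; exact: H.
have Kle1 x : (pot (kern b) mu (\1_K) x <= pot (kern b) mu (fun=> 1%R) x)%E.
  by apply: pot_le => // y; rewrite lee_wpmul2l ?kern_ge0// lee_fin.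
have Afin x : A x -> (pot (kern b) mu (\1_K) x < +oo)%E.
  move=> [_ Sx]; apply: le_lt_trans (Kle1 x) _; rewrite ltey; apply/eqP => E.
  exact: Sx.
have dle k x : (pot (kdiff b k.+1%:R^-1) mu (\1_K) x <= pot (kern b) mu (\1_K) x)%E.
  apply: pot_le => // y; apply: lee_wpmul2r; first by rewrite lee_fin.
  by rewrite (kern_split b k.+1%:R^-1) leeDl// lee_fin kreg_ge0.
have dfin k x : A x -> pot (kdiff b k.+1%:R^-1) mu (\1_K) x \is a fin_num.
  by move=> Ax; rewrite ge0_fin_numE ?pot_ge0//; apply: le_lt_trans (dle k x) (Afin x Ax).
pose F (k : nat) (x : borelRn R n) : R := fine (pot (kdiff b k.+1%:R^-1) mu (\1_K) x).
have mF k : measurable_fun A (F k).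
  apply: (@measurable_funS _ _ _ _ setT) => //.
  by apply: measurableT_comp => //; exact: pot_measurable.
have Fcvg x : A x -> F ^~ x @ \oo --> (cst 0 : borelRn R n -> R) x.
  move=> Ax; apply: fine_cvg; exact: pot_kdiff_cvg0 b0 KP (Afin x Ax).
have e2 : 0 < e / 2 by rewrite divr_gt0.
have [N [mN muN unif]] := pointwise_almost_uniform mF mA
  (eq_ind_r (fun t => t < +oo)%E muKoo muA) Fcvg e2.
have mAN : measurable (A `\` N) by exact: measurableD.
have muAN : (mu K - (e / 2)%:E <= mu (A `\` N))%E.
  rewrite leeBlDr// -muA (measureDI _ mA mN) leeD2l//.
  by apply: le_trans (ltW muN); apply: le_measure; rewrite ?inE//; exact: measurableI.
have muANfin : mu (A `\` N) \is a fin_num.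
  rewrite ge0_fin_numE//; apply: le_lt_trans muKoo.
  by apply: le_measure; rewrite ?inE// => x [[]].
have [|B [cB BAN muB]] := @radon_compact_gt R n mu (A `\` N)
  (mu (A `\` N) - (e / 2)%:E)%E rmu mAN.
  by rewrite lteBlDr// lteDl// lte_fin.
exists B; split => //.
- by move=> x /BAN[[]].
- move: muAN muB; rewrite leeBlDr// lteBlDr// => /le_trans H /ltW muB; apply: H.
  rewrite [in leRHS](splitr e) EFinD addeA; exact: leeD2r.
move=> d d0.
pose c := 4^-1 `^ (- b) : R; have c0 : 0 < c by rewrite powR_gt0// invr_gt0.
have dc0 : 0 < d / c by rewrite divr_gt0.
pose P := [set h : borelRn R n -> R | forall y, (A `\` N) y ->
  ball ((cst 0 : borelRn R n -> R) y) (d / c) (h y)].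
have [k _ /(_ k (leqnn k)) Hk] : \forall k \near \oo, P (F k).
  apply: unif; apply/uniform_nbhs.
  exists [set xy | ball xy.1 (d / c) xy.2]; split => //.
  exact: (entourage_ball _ (PosNum dc0)).
exists (4^-1 * k.+1%:R^-1).
  rewrite mulr_gt0 ?invr_gt0//= mulr_ile1 ?invr_ge0//; last by rewrite invf_le1// ler1n.
  by rewrite invf_le1// ler1n.
move=> x.
have BP := mfun_ge0_indic (compact_measurable_rV cB).
have -> : d = c * (d / c) by rewrite mulrC divfK// gt_eqF.
apply: (pot_le_on_support (k' := kdiff b k.+1%:R^-1)) cB _ _ _ x => //.
- exact: ltW.
- exact: ltW.
- by apply: kernel_ge0_kdiff => //; rewrite mulr_ge0.
- by move=> y By; rewrite indicE memNset.
- move=> x x' y H.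
  have := @kdiff_le_dilate R n b (4^-1 * k.+1%:R^-1) x x' y b0 _ H.
  rewrite mulrA mulfV// mul1r; apply.
  by rewrite mulr_gt0// invr_gt0.
- move=> x Bx; apply: (@le_trans _ _ (pot (kdiff b k.+1%:R^-1) mu (\1_K) x)).
    apply: pot_le => // y; apply: lee_wpmul2l; first exact: kdiff_ge0.
    rewrite lee_fin !indicE ler_nat; case: (boolP (y \in B)) => // /set_mem/BAN[[Ky _] _].
    by rewrite mem_set.
  have ANx := BAN x Bx; have [Ax _] := ANx.
  rewrite -(fineK (dfin k x Ax)) lee_fin -/(F k x).
  by have := Hk x ANx; rewrite /ball/= sub0r normrN => /ltW; apply: le_trans; exact: ler_norm.
Qed.

End Egorov.

(** * The discrete obstacle problem *)

(** Minimise the energy [<(T + e) f, f> - 2 <f, 1>] of the l2-space with weights m,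
    where [T f i = \sum_j k i j * m j * f j], over the box [0 <= f <= 1 / e].
    One-coordinate variations give the inequality and the complementarity
    condition; the upper face of the box is harmless, because there [e * f i]
    alone already reaches 1.  Indices of zero weight are invisible to the energy,
    and their values are prescribed afterwards. *)
Lemma discrete_obstacle (R : realType) (N : nat) (k : 'I_N -> 'I_N -> R)
    (m : 'I_N -> R) (e : R) :
  (forall i j, k i j = k j i) -> (forall i j, 0 <= k i j) ->
  (forall i, 0 <= m i) -> 0 < e ->
  exists f : 'I_N -> R, forall i,
    [/\ 0 <= f i, e * f i <= 1, 1 <= e * f i + \sum_j k i j * m j * f j &
        0 < f i -> e * f i + \sum_j k i j * m j * f j = 1].
Proof.
move=> ksym k0 m0 e0.
pose A : 'M[R]_N := \matrix_(i, j) (m i * m j * k i j + e * m i *+ (i == j)).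
pose c : 'cV[R]_N := \col_i m i.
pose Q (v : 'rV[R]_N) : R := (v *m A *m v^T) 0 0 - 2 * (v *m c) 0 0.
pose Box := [set v : 'rV[R]_N | forall i, `[0, e^-1]%classic (v ord0 i)].
have cBox : compact Box.
  by apply: (@rV_compact R N (fun=> `[0, e^-1]%classic)) => i; exact: segment_compact.
have Box0 : Box !=set0.
  by exists 0 => i; rewrite mxE /= in_itv/= lexx invr_ge0 ltW.
have Asym : A^T = A.
  apply/matrixP => i j; rewrite !mxE ksym (mulrC (m j)) eq_sym.
  by have [->|] := eqVneq i j.
have cQ : continuous Q.
  have cc (i : 'I_N) : continuous (fun v : 'rV[R]_N => v 0 i) by exact: coord_continuous.
  have -> : Q = (fun v => \sum_j (\sum_i v 0 i * A i j) * v 0 j -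
                2 * \sum_j v 0 j * m j).
    apply/funext => v; rewrite /Q !mxE; congr (_ - 2 * _); last first.
      by apply: eq_bigr => j _; rewrite !mxE.
    by apply: eq_bigr => j _; rewrite !mxE.
  move=> v; apply: (@continuousB _ _ _
    (fun v : 'rV[R]_N => \sum_j (\sum_i v 0 i * A i j) * v 0 j)
    (fun v : 'rV[R]_N => 2 * \sum_j v 0 j * m j)).
    apply: continuous_sum_fun => j w.
    apply: (@continuousM _ _ (fun v : 'rV[R]_N => \sum_i v 0 i * A i j)
      (fun v : 'rV[R]_N => v 0 j)); last exact: cc.
    apply: continuous_sum_fun => i u.
    apply: (@continuousM _ _ (fun v : 'rV[R]_N => v 0 i) (cst (A i j))); first exact: cc.
    exact: cst_continuous.
  apply: (@continuousM _ _ (cst 2) (fun v : 'rV[R]_N => \sum_j v 0 j * m j)).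
    exact: cst_continuous.
  apply: continuous_sum_fun => i u.
  apply: (@continuousM _ _ (fun v : 'rV[R]_N => v 0 i) (cst (m i))); first exact: cc.
  exact: cst_continuous.
have [v /set_mem vBox vmin] := EVT_min_rV Box0 cBox (continuous_subspaceT cQ).
have v0 i : 0 <= v 0 i by have := vBox i; rewrite /= in_itv/= => /andP[].
have v1 i : e * v 0 i <= 1.
  have := vBox i; rewrite /= in_itv/= => /andP[_].
  by rewrite -(ler_pM2l e0) divff// gt_eqF.
pose G i := \sum_j k i j * m j * v 0 j + e * v 0 i - 1.
have AvE i : (A *m v^T) i 0 = m i * (G i + 1).
  rewrite !mxE /G subrK mulrDr mulr_sumr.
  have -> : m i * (e * v 0 i) = \sum_j (e * m i *+ (i == j)) * v 0 j.
    rewrite (bigD1 i)//= eqxx mulr1n big1 ?addr0; first by ring.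
    by move=> j /negbTE; rewrite eq_sym => ->; rewrite mulr0n mul0r.
  by rewrite -big_split/=; apply: eq_bigr => j _; rewrite !mxE; ring.
have Qdiff i t : Q (v + t *: delta_mx 0 i) - Q v =
    2 * t * m i * G i + t ^+ 2 * A i i.
  set d : 'rV[R]_N := delta_mx 0 i.
  have E1 : (d *m A *m v^T) 0 0 = m i * (G i + 1).
    by rewrite -AvE -mulmxA -rowE mxE.
  have E2 : (v *m A *m d^T) 0 0 = m i * (G i + 1).
    have -> : v *m A *m d^T = (d *m A *m v^T)^T.
      by rewrite !trmx_mul trmxK Asym mulmxA.
    by rewrite [LHS]mxE.
  have E3 : (d *m A *m d^T) 0 0 = A i i.
    by rewrite trmx_delta -mulmxA -rowE mxE -colE mxE.
  have E4 : (d *m c) 0 0 = m i by rewrite -rowE !mxE.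
  have -> : Q (v + t *: d) = Q v + t * (v *m A *m d^T) 0 0 + t * (d *m A *m v^T) 0 0
     + t ^+ 2 * (d *m A *m d^T) 0 0 - 2 * (t * (d *m c) 0 0).
    have -> : v + t *: d = v + t%:M *m d by rewrite mul_scalar_mx.
    rewrite /Q mul_scalar_mx linearD linearZ/= !mulmxDl !mulmxDr -!scalemxAl.
    rewrite -!scalemxAr !mxE; ring.
  rewrite E1 E2 E3 E4; ring.
have step i t : 0 <= v 0 i + t <= e^-1 -> 0 <= 2 * t * m i * G i + t ^+ 2 * A i i.
  move=> vt; rewrite -Qdiff subr_ge0; apply/vmin/mem_set => j.
  rewrite /= in_itv/= !mxE eqxx/=; have [->|ji] := eqVneq j i; first by rewrite mulr1.
  by rewrite mulr0 addr0; have := vBox j; rewrite /= in_itv.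
have A0 i : 0 <= A i i by rewrite mxE eqxx mulr1n addr_ge0// !mulr_ge0// ltW.
pose S i := \sum_j k i j * m j * v 0 j.
have S0 i : 0 <= S i by apply: sumr_ge0 => j _; rewrite !mulr_ge0.
(* a step so short that the quadratic term cannot offset the linear one *)
have small i (p r : R) : 0 < p -> 0 < r ->
    exists t : R, [/\ 0 < t, t <= r & t * A i i < p].
  move=> p0 r0; have A1 : 0 < A i i + 1 by rewrite ltr_wpDl.
  exists (Num.min r (p / (A i i + 1))); split.
  - by rewrite lt_min r0 divr_gt0.
  - by rewrite ge_min lexx.
  apply: (@le_lt_trans _ _ (p / (A i i + 1) * A i i)).
    by rewrite ler_wpM2r// ge_min lexx orbT.
  by rewrite mulrAC ltr_pdivrMr// ltr_pM2l// ltrDl.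
have G0 i : 0 < m i -> 0 <= G i.
  move=> mi; rewrite leNgt; apply/negP => Gi.
  have r0 : 0 < e^-1 - v 0 i.
    rewrite subr_gt0 -(ltr_pM2l e0) divff ?gt_eqF//.
    by have := S0 i; move: Gi; rewrite /G -/(S i); lra.
  have p0 : 0 < - (m i * G i) by rewrite oppr_gt0 pmulr_rlt0.
  have [t [t0 tr tp]] := small i _ _ p0 r0.
  have := step i t; have -> : 2 * t * m i * G i + t ^+ 2 * A i i =
    t * (2 * (m i * G i) + t * A i i) by ring.
  rewrite pmulr_rge0//; have := v0 i; lra.
have G1 i : 0 < m i -> 0 < v 0 i -> G i <= 0.
  move=> mi vi; rewrite leNgt; apply/negP => Gi.
  have p0 : 0 < m i * G i by rewrite mulr_gt0.
  have [t [t0 tr tp]] := small i _ _ p0 vi.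
  have := step i (- t); have -> : 2 * (- t) * m i * G i + (- t) ^+ 2 * A i i =
    t * (t * A i i - 2 * (m i * G i)) by ring.
  have vie : v 0 i <= e^-1 by have := vBox i; rewrite /= in_itv/= => /andP[].
  rewrite pmulr_rge0//; lra.
pose f i := if m i == 0 then Num.max 0 ((1 - S i) / e) else v 0 i.
have fE i : \sum_j k i j * m j * f j = S i.
  apply: eq_bigr => j _; rewrite /f; case: eqP => // ->.
  by rewrite mulr0 !mul0r.
exists f => i; rewrite fE /f; have [mi0|mi0] := eqVneq (m i) 0.
  have [Si|Si] := leP ((1 - S i) / e) 0.
    have S1 : 1 <= S i.
      by move: Si; rewrite pmulr_lle0 ?invr_gt0// subr_le0.
    by rewrite mulr0 add0r; split => //; rewrite ltxx.
  have -> : e * ((1 - S i) / e) = 1 - S i by field; rewrite gt_eqF.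
  by rewrite subrK; split => //; [exact: ltW | rewrite gerBl].
have mi : 0 < m i by rewrite lt_def mi0 m0.
split => //; first by have := G0 i mi; rewrite /G -/(S i); lra.
by move=> vi; have := G0 i mi; have := G1 i mi vi; rewrite /G -/(S i); lra.
Qed.

(** * Frostman's maximum principle *)

Section Frostman.
Context (R : realType) (n : nat).
Implicit Types (x y z : 'rV[R]_n) (K D S : set 'rV[R]_n).
Implicit Types (mu nu : {measure set (borelRn R n) -> \bar R}).

Definition shift x (d : R) (i : 'I_n) : 'rV[R]_n := x + d *: delta_mx 0 i.

Lemma sqdist_shift x y (d : R) i :
  sqdist (shift x d i) y = sqdist x y + d ^+ 2 + 2 * d * (x 0 i - y 0 i).
Proof.
rewrite /shift /sqdist (bigD1 i)//= [in RHS](bigD1 i)//= !mxE !eqxx/= mulr1.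
rewrite [X in _ + X = _](_ : _ = \sum_(j < n | j != i) (x 0 j - y 0 j) ^+ 2); last first.
  by apply: eq_bigr => j /negbTE ji; rewrite !mxE eqxx ji/= mulr0 addr0.
by ring.
Qed.

Lemma powR_le_kern b x y : ((sqdist x y `^ (- b))%:E <= kern b x y)%E.
Proof. by rewrite /kern; case: ifP => // _; exact: leey. Qed.

(** Away from its pole the kernel is discretely subharmonic up to an error of
    order [d ^+ 4]. *)
Lemma kern_second_difference b (s0 d : R) x y :
  0 < b -> n%:R <= 2 * b + 2 -> 0 < s0 -> s0 <= sqdist x y -> 0 < d ->
  d ^+ 2 < s0 -> b * d ^+ 2 <= s0 ->
  ((2 * n%:R)%:E * kern b x y <=
   \sum_(i < n) (kern b (shift x d i) y + kern b (shift x (- d)%R i) y)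
   + ((8 * b * (b + 1) + 4 * b ^+ 2 * (b + 1)) / s0 ^+ 2 * s0 `^ (- b) * d ^+ 4)%:E)%E.
Proof.
move=> b0 nb s00 s0s d0 ds bds; set C := 8 * b * (b + 1) + _.
have C0 : 0 <= C by rewrite addr_ge0// !mulr_ge0 ?sqr_ge0//; lra.
set s := sqdist x y in s0s *; have s'0 : 0 < s by lra.
have xy : x != y by rewrite -sqdist_eq0 gt_eqF.
rewrite /kern (negbTE xy) -/s -/(kern b _ _).
have := @powRN_second_difference R n b s d (fun i => x 0 i - y 0 i) b0 nb erefl s'0 d0.
rewrite -/C => /(_ ltac:(lra) ltac:(lra)) H.
have H1 : ((\sum_(i < n) ((s + d ^+ 2 + 2 * d * (x 0 i - y 0 i)) `^ (- b) +
     (s + d ^+ 2 - 2 * d * (x 0 i - y 0 i)) `^ (- b)))%R%:E <=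
  \sum_(i < n) (kern b (shift x d i) y + kern b (shift x (- d)%R i) y))%E.
  rewrite -sumEFin; apply: lee_sum => i _; rewrite EFinD; apply: leeD.
    by rewrite -sqdist_shift; exact: powR_le_kern.
  have -> : s + d ^+ 2 - 2 * d * (x 0 i - y 0 i) =
      s + (- d) ^+ 2 + 2 * - d * (x 0 i - y 0 i) by ring.
  by rewrite -sqdist_shift; exact: powR_le_kern.
apply: le_trans (leeD2r _ H1); rewrite -EFinM -EFinD lee_fin.
rewrite -lerBlDr; apply: le_trans H; rewrite mulrBl lerD2l lerN2.
have -> : C / s0 ^+ 2 * s0 `^ (- b) * d ^+ 4 = C * (d ^+ 2 / s0) ^+ 2 * s0 `^ (- b).
  by field; rewrite gt_eqF.
have ss : s `^ (- b) <= s0 `^ (- b) by exact: powRN_le.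
apply: ler_pM => //; rewrite ?powR_ge0//; first by rewrite mulr_ge0// sqr_ge0.
rewrite ler_wpM2l// lerXn2r ?nnegrE ?divr_ge0 ?sqr_ge0 ?(ltW s00) ?(ltW s'0)//.
by rewrite ler_wpM2l ?sqr_ge0// lef_pV2 ?posrE.
Qed.

Lemma pot_second_difference b (s0 d M : R) mu f x :
  0 < b -> n%:R <= 2 * b + 2 -> 0 < s0 -> 0 < d ->
  d ^+ 2 < s0 -> b * d ^+ 2 <= s0 -> mfun_ge0 f ->
  (forall y, 0 < f y -> s0 <= sqdist x y) ->
  (\int[mu]_y (f y)%:E <= M%:E)%E ->
  ((2 * n%:R)%:E * pot (kern b) mu f x <=
   \sum_(i < n) (pot (kern b) mu f (shift x d i)
                 + pot (kern b) mu f (shift x (- d)%R i))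
   + ((8 * b * (b + 1) + 4 * b ^+ 2 * (b + 1)) / s0 ^+ 2 * s0 `^ (- b) * d ^+ 4 * M)%:E)%E.
Proof.
move=> b0 nb s00 d0 ds bds fP far IM; have kP := @kernel_ge0_kern R n b.
have [mf f0] := fP.
set c := _ / s0 ^+ 2 * s0 `^ (- b) * d ^+ 4.
have c0 : 0 <= c.
  rewrite !mulr_ge0 ?powR_ge0 ?invr_ge0 ?exprn_ge0 ?(ltW d0) ?(ltW s00)//.
  by rewrite addr_ge0// !mulr_ge0 ?sqr_ge0//; lra.
pose g i (y : borelRn R n) := (kern b (shift x d i) y * (f y)%:E
  + kern b (shift x (- d)%R i) y * (f y)%:E)%E.
have g0 i y : (0 <= g i y)%E by rewrite adde_ge0// integrand_ge0.
have mg i : measurable_fun setT (g i).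
  by apply: emeasurable_funD; exact: integrand_measurable.
apply: (@le_trans _ _ (\int[mu]_y (\sum_(i < n) g i y + c%:E * (f y)%:E))%E).
  rewrite /pot -ge0_integralZl_EFin//; first last.
  - exact: integrand_measurable.
  - by move=> y _; exact: integrand_ge0.
  apply: ge0_le_integral => //.
  - by move=> y _; rewrite mule_ge0// ?lee_fin ?mulr_ge0// integrand_ge0.
  - by apply: emeasurable_funM; [exact: measurable_cst | exact: integrand_measurable].
  - apply: emeasurable_funD; first exact: emeasurable_sum.
    by apply: emeasurable_funM; [exact: measurable_cst | exact/measurable_EFinP].
  move=> y _; have [fy0|fy0] := eqVneq (f y) 0.
    by rewrite fy0 !mule0 adde0; exact: sume_ge0.
  have fy : 0 < f y by rewrite lt_def fy0 f0.
  have H := kern_second_difference b0 nb s00 (far y fy) d0 ds bds.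
  rewrite muleA; apply: le_trans (lee_wpmul2r _ H) _; first by rewrite lee_fin.
  rewrite -/c ge0_muleDl ?lee_fin//; last first.
    by apply: sume_ge0 => i _; rewrite adde_ge0// kern_ge0.
  rewrite leeD2r// ge0_sume_distrl; last by move=> i _; rewrite adde_ge0// kern_ge0.
  by apply: lee_sum => i _; rewrite ge0_muleDl// kern_ge0.
rewrite ge0_integralD//; first last.
- by apply: emeasurable_funM; [exact: measurable_cst | exact/measurable_EFinP].
- by move=> y _; rewrite mule_ge0// lee_fin.
- exact: emeasurable_sum.
- by move=> y _; exact: sume_ge0.
apply: leeD.
  rewrite ge0_integral_sum//; apply: lee_sum => i _.
  rewrite ge0_integralD//.
  - by move=> y _; exact: integrand_ge0.
  - exact: integrand_measurable.
  - by move=> y _; exact: integrand_ge0.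
  - exact: integrand_measurable.
clearbody c; rewrite ge0_integralZl_EFin//; first by rewrite EFinM lee_wpmul2l// lee_fin.
- by move=> y _; rewrite lee_fin.
- exact/measurable_EFinP.
Qed.

Lemma pot_le_far b (s M : R) mu f x : 0 < b -> 0 < s -> mfun_ge0 f ->
  (forall y, 0 < f y -> s <= sqdist x y) -> (\int[mu]_y (f y)%:E <= M%:E)%E ->
  (pot (kern b) mu f x <= (s `^ (- b) * M)%:E)%E.
Proof.
move=> b0 s0 fP far IM; have [mf f0] := fP.
apply: (@le_trans _ _ (\int[mu]_y ((s `^ (- b))%:E * (f y)%:E))%E); last first.
  rewrite ge0_integralZl_EFin ?powR_ge0//.
  - by rewrite EFinM lee_wpmul2l// lee_fin powR_ge0.
  - by move=> y _; rewrite lee_fin.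
  - exact/measurable_EFinP.
apply: ge0_le_integral => //.
- by move=> y _; apply: integrand_ge0 => //; exact: kernel_ge0_kern.
- by apply: integrand_measurable => //; exact: kernel_ge0_kern.
- by apply: emeasurable_funM; [exact: measurable_cst | exact/measurable_EFinP].
move=> y _; have [fy0|fy0] := eqVneq (f y) 0; first by rewrite fy0 !mule0.
have fy : 0 < f y by rewrite lt_def fy0 f0.
apply: lee_wpmul2r; first by rewrite lee_fin.
have sy := far y fy; rewrite /kern -sqdist_eq0 gt_eqF ?(lt_le_trans s0)//.
by rewrite lee_fin; exact: powRN_le.
Qed.

(** Frostman's maximum principle for a continuous potential [p].  If [p] exceeded
    [a] somewhere, then, [p] being small at infinity, [p] plus a small multiple
    [eta] of [|x| ^ 2] would have a maximum [x0] over a large box, interior to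
    it and off the closed support of [f mu].  The second difference at [x0] is
    then at most [- 2 n eta d ^+ 2] for [p] because of the maximum, but at least
    of order [- d ^+ 4] because the kernel is subharmonic near [x0]: a
    contradiction for small steps [d]. *)
Lemma frostman_maximum_principle b mu f (M a : R) K (p : 'rV[R]_n -> R) :
  0 < b -> n%:R <= 2 * b + 2 -> (0 < n)%N -> compact K -> mfun_ge0 f ->
  (forall y, ~ K y -> f y = 0) -> (\int[mu]_y (f y)%:E <= M%:E)%E ->
  continuous p -> (forall x, pot (kern b) mu f x = (p x)%:E) -> 0 <= a ->
  (forall x, 0 < f x -> p x <= a) -> forall x, p x <= a.
Proof.
move=> b0 nb n0 cK fP fK IM cp pE a0 pa x1; have [mf f0] := fP.
have M0 : 0 <= M.
  by rewrite -lee_fin; apply: le_trans IM; apply: integral_ge0 => y _; rewrite lee_fin.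
have p0 x : 0 <= p x by rewrite -lee_fin -pE; apply: pot_ge0 => //; exact: kernel_ge0_kern.
have SK y : 0 < f y -> K y.
  by move=> fy; apply: contrapT => Ky; rewrite fK ?ltxx in fy.
rewrite leNgt; apply/negP => apx1.
pose F := closure [set y | 0 < f y].
have FK : F `<=` K.
  have : closed K by apply: compact_closed => //; exact: norm_hausdorff.
  by rewrite closure_id => KE; rewrite KE; apply: closure_subset => y; exact: SK.
have cF : compact F by apply: subclosed_compact FK => //; exact: closed_closure.
have pF x : F x -> p x <= a.
  have cl : closed [set x | p x <= a].
    apply: (@closed_comp _ _ p [set t | t <= a]) => [y _|]; first exact: cp.
    exact: closed_le.
  move=> Fx; suff : [set x | p x <= a] x by [].
  by rewrite ((closure_id _).1 cl); apply: closure_subset Fx => y; exact: pa.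
have [F0|/set0P F0] := eqVneq F set0.
  have : p x1 = 0.
    apply/eqP; rewrite -eqe -pE; apply/eqP/integral0_eq => y _.
    rewrite (_ : f y = 0) ?mule0//; apply/eqP; rewrite eq_le f0 andbT leNgt.
    apply/negP => fy; have : F y by exact: subset_closure.
    by rewrite F0.
  by move=> E; rewrite E in apx1; lra.
pose dd := (p x1 - a) / 2; have dd0 : 0 < dd by rewrite /dd; lra.
(* s is chosen so that [s `^ (- b) * (M + 1) = dd], which makes the potential
   smaller than dd at distance more than [sqrt s] from K *)
pose s := (dd / (M + 1)) `^ (- b^-1).
have M1 : 0 < M + 1 by lra.
have s0 : 0 < s by rewrite powR_gt0// divr_gt0.
have sM : s `^ (- b) * M < dd.
  have t0 : 0 <= dd / (M + 1) by exact: divr_ge0 (ltW dd0) (ltW M1).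
  rewrite /s -powRrM mulrNN mulVf ?gt_eqF// (powRr1 t0).
  by rewrite mulrAC ltr_pdivrMr// ltr_pM2l// ltrDl.
have [L L0 KL] := compact_sub_box cK.
have [L1 L10 x1L] := compact_sub_box (@compact_set1 _ x1).
have far x : ~ box (L + s + 1) x -> p x < dd.
  move=> /existsNP[i /negP]; rewrite -ltNge => xi.
  apply: (le_lt_trans _ sM); rewrite -lee_fin -pE; apply: pot_le_far => // y fy.
  apply: le_trans (sqdist_coord x y i).
  rewrite -[leRHS]ger0_norm ?sqr_ge0// normrX.
  have := lerB_dist (x 0 i) (y 0 i); have := KL _ (SK y fy) i => Hy Hd.
  have xy : s + 1 <= `|x 0 i - y 0 i| by lra.
  apply: (@le_trans _ _ ((s + 1) ^+ 2)); first by nra.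
  by rewrite lerXn2r ?nnegrE//; lra.
pose L' := L + s + 2 + L1.
pose Z := n%:R * L' ^+ 2; have L'0 : 0 < L' by rewrite /L'; lra.
have Z0 : 0 < Z by rewrite mulr_gt0 ?ltr0n// exprn_gt0.
have boxZ x : box L' x -> sqdist x 0 <= Z.
  move=> xL; rewrite /Z mulr_natl -[in leRHS](card_ord n) -sumr_const ler_sum// => i _.
  rewrite mxE subr0 -[leLHS]ger0_norm ?sqr_ge0// normrX lerXn2r ?nnegrE ?(ltW L'0)//.
pose eta := dd / (2 * Z); have eta0 : 0 < eta by rewrite divr_gt0// mulr_gt0.
have etaZ : eta * Z = dd / 2 by rewrite /eta; field; rewrite gt_eqF.
pose u x := p x + eta * sqdist x 0.
have cu : continuous u.
  move=> x; apply: (@continuousD _ _ _ p (fun x => eta * sqdist x 0)); first exact: cp.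
  apply: (@continuousM _ _ (cst eta) (fun x => sqdist x 0)); first exact: cst_continuous.
  exact: continuous_sqdist.
have x1box : box L' x1 by move=> i; apply: le_trans (x1L _ erefl i) _; rewrite /L'; lra.
have [x0 /set_mem x0box x0max] := @EVT_max_rV R n u (box L')
  (ex_intro _ x1 x1box) (@compact_box R n L') (continuous_subspaceT cu).
have px0 : a + dd < p x0.
  have := x0max x1 (mem_set x1box); rewrite /u.
  have := boxZ x0 x0box; rewrite -(ler_pM2l eta0) etaZ.
  have : 0 <= eta * sqdist x1 0 by rewrite mulr_ge0 ?sqdist_ge0// ltW.
  rewrite /dd; lra.
have x0in : box (L + s + 1) x0.
  by apply: contrapT => /far; lra.
have x0F : ~ F x0 by move=> /pF; lra.
have [y0 /set_mem Fy0 y0min] := @EVT_min_rV R n (fun y => sqdist y x0) F F0 cF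
  (continuous_subspaceT (@continuous_sqdist R n x0)).
pose s0' := sqdist y0 x0.
have s0'0 : 0 < s0' by apply: sqdist_gt0; apply/eqP => E; rewrite E in Fy0.
have sfar y : 0 < f y -> s0' <= sqdist x0 y.
  by move=> fy; rewrite sqdistC; apply: y0min; apply: mem_set; exact: subset_closure.
pose C := (8 * b * (b + 1) + 4 * b ^+ 2 * (b + 1)) / s0' ^+ 2 * s0' `^ (- b).
have C0 : 0 <= C.
  rewrite !mulr_ge0 ?powR_ge0 ?invr_ge0 ?exprn_ge0 ?(ltW s0'0)//.
  by rewrite addr_ge0// !mulr_ge0 ?sqr_ge0//; lra.
have CM0 : 0 <= C * M by rewrite mulr_ge0.
(* a step d with d ^ 2 small against every constant met so far *)
pose d := Num.min 1 (Num.min (s0' / (2 + b)) (2 * n%:R * eta / (C * M + 1))).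
have n0' : 0 < n%:R :> R by rewrite ltr0n.
have d0 : 0 < d.
  rewrite !lt_min ltr01/=; apply/andP; split; first by apply: divr_gt0 => //; lra.
  apply: divr_gt0; last by lra.
  by apply: mulr_gt0 => //; exact: mulr_gt0.
have d1 : d <= 1 by rewrite ge_min lexx.
have d2 : d <= s0' / (2 + b) by rewrite !ge_min lexx !orbT.
have d3 : d <= 2 * n%:R * eta / (C * M + 1) by rewrite !ge_min lexx !orbT.
have dd1 : d ^+ 2 <= d by rewrite expr2 ler_piMr// ltW.
rewrite ler_pdivlMr in d2; last by lra.
rewrite ler_pdivlMr in d3; last by lra.
have ds : d ^+ 2 < s0' by nra.
have bds : b * d ^+ 2 <= s0' by nra.
have := pot_second_difference (x := x0) b0 nb s0'0 d0 ds bds fP sfar IM.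
rewrite pE; under eq_bigr do rewrite !pE -EFinD; rewrite sumEFin -EFinM -EFinD lee_fin -/C.
apply/negP; rewrite -ltNge.
have shift_box (t : R) i : `|t| <= 1 -> box L' (shift x0 t i).
  move=> t1 j; rewrite /shift !mxE; apply: le_trans (ler_normD _ _) _.
  have H1 := x0in j; have H2 : `|t * ((0 == 0 :> 'I_1) && (j == i))%:R| <= 1.
    by rewrite eqxx/=; case: (j == i); rewrite ?mulr1 ?mulr0 ?normr0 ?ler01.
  by rewrite /L'; lra.
have Hsum : \sum_(i < n) (p (shift x0 d i) + p (shift x0 (- d) i)) <=
    \sum_(i < n) (2 * p x0 - 2 * eta * d ^+ 2).
  apply: ler_sum => i _.
  have dn : `|d| <= 1 by rewrite ger0_norm// ltW.
  have dn' : `|- d| <= 1 by rewrite normrN.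
  have := x0max _ (mem_set (shift_box d i dn)).
  have := x0max _ (mem_set (shift_box (- d) i dn')).
  by rewrite /u !sqdist_shift; nra.
apply: (le_lt_trans (lerD Hsum (lexx _))).
rewrite sumr_const card_ord -[X in X + _]mulr_natl.
have CMd : C * M * d ^+ 2 < 2 * n%:R * eta by nra.
have d20 : 0 < d ^+ 2 by rewrite exprn_gt0.
have -> : C * d ^+ 4 * M = C * M * d ^+ 2 * d ^+ 2 by ring.
by nra.
Qed.

End Frostman.

(** * Continuity of potentials *)

Section Continuity.
Context (R : realType) (n : nat).
Implicit Types (x y z : 'rV[R]_n) (B K D S : set 'rV[R]_n).
Implicit Types (mu nu : {measure set (borelRn R n) -> \bar R}).

Lemma pot_kreg_le b h mu f x : 0 < b -> 0 < h -> mfun_ge0 f ->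
  (pot (fun x y => (kreg b h x y)%:E) mu f x <=
   (h `^ (- b))%:E * \int[mu]_y (f y)%:E)%E.
Proof.
move=> b0 h0 fP; have [mf f0] := fP.
have hb0 := powR_ge0 h (- b).
rewrite -(ge0_integralZl_EFin mu measurableT _ _ hb0); last 2 first.
- by move=> y _; rewrite lee_fin.
- exact/measurable_EFinP.
have rP := @kernel_ge0_kreg R n b h.
apply: ge0_le_integral => //.
- by move=> y _; exact: (integrand_ge0 x y rP fP).
- exact: (integrand_measurable x rP fP).
- by apply: emeasurable_funM; [exact: measurable_cst | exact/measurable_EFinP].
- by move=> y _; rewrite lee_wpmul2r ?lee_fin// kreg_le.
Qed.

Lemma pot_kreg_lip b h mu f K (L d r : R) x x' : mfun_ge0 f ->
  (forall y, ~ K y -> f y = 0) -> K `<=` box L -> 0 <= d ->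
  (forall x x' y y',
    box L x -> box L x' -> box L y -> box L y' ->
    (forall i, `|x 0 i - x' 0 i| <= r) -> (forall i, `|y 0 i - y' 0 i| <= r) ->
    `|kreg b h x y - kreg b h x' y'| <= d) ->
  0 <= r -> box L x -> box L x' -> (forall i, `|x 0 i - x' 0 i| <= r) ->
  (pot (fun x y => (kreg b h x y)%:E) mu f x <=
   pot (fun x y => (kreg b h x y)%:E) mu f x' + d%:E * \int[mu]_y (f y)%:E)%E.
Proof.
move=> fP fK KL d0 H r0 xL x'L xx'; have [mf f0] := fP.
have rP := @kernel_ge0_kreg R n b h.
rewrite -ge0_integralZl_EFin//; last 2 first.
- by move=> y _; rewrite lee_fin.
- exact/measurable_EFinP.
rewrite /pot -ge0_integralD//; first last.
- by apply: emeasurable_funM; [exact: measurable_cst | exact/measurable_EFinP].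
- by move=> y _; rewrite mule_ge0// lee_fin.
- exact: (integrand_measurable x' rP fP).
- by move=> y _; exact: (integrand_ge0 x' y rP fP).
apply: ge0_le_integral => //.
- by move=> y _; exact: (integrand_ge0 x y rP fP).
- exact: (integrand_measurable x rP fP).
- apply: emeasurable_funD; first exact: (integrand_measurable x' rP fP).
  by apply: emeasurable_funM; [exact: measurable_cst | exact/measurable_EFinP].
move=> y _; have [Ky|Ky] := pselect (K y); last by rewrite fK// !mule0 adde0.
rewrite -!EFinM -EFinD lee_fin -mulrDl ler_wpM2r// -lerBlDl.
apply: le_trans (ler_norm _) _; apply: H => //; try exact: KL.
by move=> i; rewrite subrr normr0.
Qed.

Lemma pot_le_indic k mu f B (c : R) x : 0 <= c -> kernel_ge0 k -> mfun_ge0 f ->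
  measurable (B : set (borelRn R n)) -> (forall y, f y <= c * \1_B y) ->
  (pot k mu f x <= c%:E * pot k mu (\1_B) x)%E.
Proof.
move=> c0 kP fP mB fB; apply: (pot_leZ mu c0 kP kP fP (mfun_ge0_indic mB)) => y.
rewrite muleCA; apply: lee_wpmul2l; first by have [] := kP.
by rewrite -EFinM lee_fin.
Qed.

(** [p] is a uniform limit of the potentials with regularised kernels, and these
    inherit the uniform continuity of [kreg]. *)
Lemma uniformly_regularizable_continuous b mu f B (c : R) :
  0 < b -> radon mu -> compact B -> uniformly_regularizable b mu B ->
  mfun_ge0 f -> 0 <= c -> (forall y, f y <= c * \1_B y) ->
  exists p : 'rV[R]_n -> R, continuous p /\ forall x, pot (kern b) mu f x = (p x)%:E.
Proof.
move=> b0 rmu cB uB fP c0 fB; have [mf f0] := fP.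
have mB := compact_measurable_rV cB.
have kP := @kernel_ge0_kern R n b.
have fK y : ~ B y -> f y = 0.
  move=> By; apply/eqP; rewrite eq_le f0 andbT; have := fB y.
  by rewrite indicE memNset// mulr0.
have muB : (mu B < +oo)%E by have [H _] := rmu; exact: H.
have If : (\int[mu]_y (f y)%:E <= c%:E * mu B)%E.
  have -> : mu B = (\int[mu]_y (\1_B y)%:E)%E by rewrite integral_indic// setIT.
  rewrite -ge0_integralZl_EFin//; last exact/measurable_EFinP.
  apply: ge0_le_integral => //.
  - by move=> y _; rewrite lee_fin.
  - exact/measurable_EFinP.
  - by apply: emeasurable_funM => //; exact/measurable_EFinP.
  - by move=> y _; rewrite -EFinM lee_fin.
have If0 : (0 <= \int[mu]_y (f y)%:E)%E by apply: integral_ge0 => y _; rewrite lee_fin.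
have Iffin : (\int[mu]_y (f y)%:E)%E \is a fin_num.
  rewrite ge0_fin_numE//; apply: le_lt_trans If _.
  by apply: lte_mul_pinfty => //; rewrite lee_fin.
have kregfin h x : 0 < h -> pot (fun x y => (kreg b h x y)%:E) mu f x \is a fin_num.
  move=> h0; rewrite ge0_fin_numE; last by apply: pot_ge0 => //; exact: kernel_ge0_kreg.
  apply: le_lt_trans (pot_kreg_le mu x b0 h0 fP) _.
  by rewrite -(fineK Iffin) -EFinM ltry.
have small d : 0 < d -> exists2 h : R, 0 < h & forall x,
    (pot (kdiff b h) mu f x <= d%:E)%E.
  move=> d0; have [|h /andP[h0 _] H] := uB (d / (c + 1)).
    by rewrite divr_gt0//; lra.
  exists h => // x; have dP := @kernel_ge0_kdiff R n b h b0 (ltW h0).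
  apply: le_trans (pot_le_indic mu x c0 dP fP mB fB) _.
  apply: le_trans (lee_wpmul2l _ (H x)) _; first by rewrite lee_fin.
  rewrite -EFinM lee_fin mulrCA ler_piMr ?(ltW d0)// ler_pdivrMr; lra.
have kfin x : pot (kern b) mu f x \is a fin_num.
  have [h h0 H] := small 1 ltr01.
  rewrite (pot_split mu x b0 (ltW h0) fP) fin_numD kregfin// andbT.
  rewrite ge0_fin_numE; first by apply: le_lt_trans (H x) _; exact: ltry.
  by apply: pot_ge0 => //; apply: kernel_ge0_kdiff => //; exact: ltW.
exists (fun x => fine (pot (kern b) mu f x)); split; last by move=> x; rewrite fineK.
set I := (\int[mu]_y (f y)%:E)%E in If If0 Iffin *.
move=> x W /nbhs_ballP[e2 /= e20 eW]; pose e := e2 / 2.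
have e0 : 0 < e by rewrite divr_gt0.
have e4 : 0 < e / 2 by rewrite divr_gt0.
have [h h0 H] := small _ e4.
have dP := @kernel_ge0_kdiff R n b h b0 (ltW h0).
have [L1 L10 BL] := compact_sub_box cB.
have [L2 L20 xL] := compact_sub_box (@compact_set1 _ x).
pose L := L1 + L2 + 1.
have BL' : B `<=` box L by move=> y By i; apply: le_trans (BL y By i) _; rewrite /L; lra.
have I0 : 0 <= fine I by exact: fine_ge0.
pose d := e / 2 / (fine I + 1); have d0 : 0 < d by rewrite divr_gt0//; lra.
have dI : d * fine I <= e / 2.
  by rewrite /d mulrAC ler_pdivrMr ?ler_wpM2l ?(ltW e4)//; lra.
have [r r0 Hr] := @kreg_unif_cont R n b h L d b0 h0 d0.
have box_x x' : (forall i, `|x 0 i - x' 0 i| <= 1) -> box L x'.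
  move=> xx' i; have := xx' i; have := xL x erefl i; rewrite distrC => A1 A2.
  by have := lerB_dist (x' 0 i) (x 0 i); rewrite /L; lra.
have bx : box L x by apply: box_x => i; rewrite subrr normr0.
have key x1 x2 : box L x1 -> box L x2 -> (forall i, `|x1 0 i - x2 0 i| <= r) ->
    fine (pot (kern b) mu f x1) - fine (pot (kern b) mu f x2) <= e.
  move=> b1 b2 x12; rewrite lerBlDr -lee_fin (fineK (kfin x1)) EFinD (fineK (kfin x2)).
  rewrite (pot_split mu x1 b0 (ltW h0) fP) (pot_split mu x2 b0 (ltW h0) fP).
  have A1 := pot_kreg_lip mu fP fK BL' (ltW d0) Hr (ltW r0) b1 b2 x12.
  apply: le_trans (leeD (H x1) A1) _.
  rewrite addeCA [leRHS]addeA [leRHS]addeC leeD2l// -/I -(fineK Iffin) -EFinM -EFinD.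
  apply: (@le_trans _ _ e%:E); last by rewrite leeDl// pot_ge0.
  by rewrite lee_fin; lra.
apply/nbhs_ballP; exists (Num.min r 1) => /= [|x' [_ Bx']]; first by rewrite lt_min r0 ltr01.
have xx' : forall i, `|x 0 i - x' 0 i| <= Num.min r 1 by move=> i; exact/ltW/Bx'.
have x'L : box L x' by apply: box_x => i; apply: le_trans (xx' i) _; rewrite ge_min lexx orbT.
have xx'r i : `|x 0 i - x' 0 i| <= r by apply: le_trans (xx' i) _; rewrite ge_min lexx.
apply: eW; rewrite /ball/=; apply: (@le_lt_trans _ _ e); last by rewrite /e; lra.
rewrite ler_norml; apply/andP; split; last exact: key.
by rewrite lerNl opprB; apply: key => // i; rewrite distrC.
Qed.

End Continuity.

(** * Partitions of compact sets into small cells *)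

Lemma compact_finite_partition (R : realType) (n : nat) (B : set 'rV[R]_n) (r : R) :
  compact B -> 0 < r ->
  exists (N : nat) (c : 'I_N -> 'rV[R]_n) (C : 'I_N -> set (borelRn R n)),
  [/\ forall i, B (c i), forall i, measurable (C i), forall i, C i `<=` B,
      (forall i x, C i x -> forall k, `|(x : 'rV[R]_n) 0 k - c i 0 k| <= r) &
      (forall x, B x -> exists i, C i x) /\
      (forall i j x, C i x -> C j x -> i = j)].
Proof.
move=> cB r0; have mB := compact_measurable_rV cB.
move: (cB); rewrite compact_cover => /(_ 'rV[R]_n B (fun y => ball y r)).
case=> [y By|x Bx|D DB BD].
- exact: ball_open.
- by exists x => //; exact: ballxx.
pose s : seq _ := finmap.enum_fset D.
pose c (j : nat) : 'rV[R]_n := nth 0 s j.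
pose C (i : nat) : set (borelRn R n) :=
  (B `&` ball (c i) r) `\` \bigcup_(j in [set j | (j < i)%N]) ball (c j) r.
have mb j : measurable (ball (c j) r : set (borelRn R n)).
  by apply: open_measurable_rV; exact: ball_open.
exists (size s), (fun i => c i), (fun i => C i); split.
- by move=> i; apply/set_mem/DB; exact: mem_nth.
- move=> i; apply: measurableD; first exact: measurableI.
  by apply: bigcup_measurable => j _.
- by move=> i x [[]].
- move=> i x [[_ [_ Bx]] _] k; rewrite distrC; apply: ltW; exact: Bx.
split.
- move=> x Bx; have [y yD xy] := BD x Bx.
  pose P j := (j < size s)%N && `[< ball (c j) r x >].
  have exP : exists j, P j.
    exists (index y s); rewrite /P index_mem; apply/andP; split; first exact: yD.
    by apply/asboolP; rewrite /c nth_index.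
  case: (ex_minnP exP) => j /andP[js /asboolP xj] jmin.
  exists (Ordinal js); split; first by split.
  move=> [k /= kj xk]; have := jmin k; rewrite /P (ltn_trans kj js)/=.
  by move=> /(_ (asboolT xk)); rewrite leqNgt kj.
- move=> i j x [[_ xi] Hi] [[_ xj] Hj]; apply/val_inj/eqP => /=.
  case: ltngtP => // ij; exfalso; [apply: Hj | apply: Hi]; by [exists i | exists j].
Qed.

(** * Approximate equilibrium measures *)

Section Equilibrium.
Context (R : realType) (n : nat).
Implicit Types (x y z : 'rV[R]_n) (B K D S : set 'rV[R]_n).
Implicit Types (mu nu : {measure set (borelRn R n) -> \bar R}).

Lemma integral_step mu N (C : 'I_N -> set (borelRn R n)) (g : 'I_N -> R) :
  (forall i, measurable (C i)) -> (forall i, 0 <= g i) ->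
  (forall i, mu (C i) \is a fin_num) ->
  (\int[mu]_y (\sum_i g i * \1_(C i) y)%:E = (\sum_i g i * fine (mu (C i)))%:E)%E.
Proof.
move=> mC g0 fC; under eq_integral do rewrite -sumEFin.
rewrite ge0_integral_sum//; last 2 first.
- move=> i; apply/measurable_EFinP; apply: measurable_funM => //.
- by move=> i y _; rewrite lee_fin mulr_ge0.
rewrite -sumEFin; apply: eq_bigr => i _; under eq_integral do rewrite EFinM.
rewrite ge0_integralZl_EFin//; last exact/measurable_EFinP.
by rewrite integral_indic// setIT EFinM fineK.
Qed.

(** An approximate equilibrium measure [f mu], with f a step function on B.

    The discrete problem is posed on the cells of a fine partition of B, with
    the kernel [kreg b h] sampled at the centres.  Where [f > 0] the equality case
    gives a potential at most 1 up to small errors, and Frostman's principle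
    extends this bound to all x.  Everywhere on B the potential is at least
    [1 - e f] up to small errors, and the integral of [e f] is small: the
    kernel is at least c on B, so that the total mass of [f mu] is at most
    [1 / c], whatever e is. *)
Lemma exists_almost_equilibrium b mu B (t : R) :
  0 < b -> n%:R <= 2 * b + 2 -> (0 < n)%N -> radon mu -> compact B ->
  uniformly_regularizable b mu B -> 0 < t ->
  exists f, [/\ mfun_ge0 f, (forall x, pot (kern b) mu f x <= (1 + t)%:E)%E &
    (mu B <= \int[mu]_x (pot (kern b) mu f x * (\1_B x)%:E) + t%:E)%E].
Proof.
move=> b0 nb n0 rmu cB uB t0.
have mB := compact_measurable_rV cB; have kP := @kernel_ge0_kern R n b.
have BP := mfun_ge0_indic mB.
have muBoo : (mu B < +oo)%E by have [H _] := rmu; exact: H.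
have muBfin : mu B \is a fin_num by rewrite ge0_fin_numE.
pose M := fine (mu B); have M0 : 0 <= M by exact: fine_ge0.
have [L L0 BL] := compact_sub_box cB.
pose c := (n%:R * (2 * L) ^+ 2 + 1) `^ (- b).
have Z0 : 0 < n%:R * (2 * L) ^+ 2 + 1 by rewrite ltr_wpDl// mulr_ge0// sqr_ge0.
have c0 : 0 < c by exact: powR_gt0.
have kreg_ge h x y : 0 < h <= 1 -> B x -> B y -> c <= kreg b h x y.
  move=> /andP[h0 h1] Bx By; apply: powRN_le => //.
    by rewrite ltr_wpDl// sqdist_ge0.
  rewrite lerD// mulr_natl -[in leRHS](card_ord n) -sumr_const ler_sum// => i _.
  rewrite -[leLHS]ger0_norm ?sqr_ge0// normrX lerXn2r ?nnegrE ?mulr_ge0 ?(ltW L0)//.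
  by apply: le_trans (ler_normB _ _) _; have := BL x Bx i; have := BL y By i; lra.
(* e is chosen first: it bounds f by [1 / e], and h and the mesh must beat that
   bound *)
pose e := t * c / 2; have e0 : 0 < e by rewrite divr_gt0// mulr_gt0.
have [|h h01 Hh] := uB (t * e / 2); first by rewrite divr_gt0// mulr_gt0.
have /andP[h0 h1] := h01.
pose d := t * e / (2 * (M + 1) ^+ 2).
have M1 : 0 < M + 1 by lra.
have d0 : 0 < d.
  by apply: divr_gt0; apply: mulr_gt0 => //; exact: exprn_gt0.
have [r r0 Hr] := @kreg_unif_cont R n b h L d b0 h0 d0.
have [N [ctr [C [ctrB mC CB Cr [Cex Cuniq]]]]] := compact_finite_partition cB r0.
have Cfin i : mu (C i) \is a fin_num.
  by rewrite ge0_fin_numE//; apply: le_lt_trans muBoo; apply: le_measure; rewrite ?inE.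
pose m i := fine (mu (C i)); have m0 i : 0 <= m i by exact: fine_ge0.
pose k i j := kreg b h (ctr i) (ctr j).
have ksym i j : k i j = k j i by exact: kregC.
have kc i j : c <= k i j by exact: kreg_ge.
have [F HF] := discrete_obstacle ksym (fun i j => le_trans (ltW c0) (kc i j)) m0 e0.
have F0 i : 0 <= F i by have [] := HF i.
have F1 i : F i <= e^-1.
  by have [_ H _ _] := HF i; rewrite -(ler_pM2l e0) divff// gt_eqF.
pose f x := \sum_i F i * \1_(C i) x.
have fC i x : C i x -> f x = F i.
  move=> Cx; rewrite /f (bigD1 i)//= indicE mem_set// mulr1 big1 ?addr0// => j ji.
  rewrite indicE memNset ?mulr0// => Cjx; move/eqP: ji; apply; exact: Cuniq Cjx Cx.
have fnB x : ~ B x -> f x = 0.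
  by move=> Bx; rewrite /f big1// => i _; rewrite indicE memNset ?mulr0// => /CB.
have mf : measurable_fun (setT : set (borelRn R n)) f.
  by apply: measurable_sum => i; apply: measurable_funM => //.
have fP : mfun_ge0 f.
  by split => // x; apply: sumr_ge0 => i _; rewrite mulr_ge0.
have f0 := proj2 fP.
have fle x : f x <= e^-1 * \1_B x.
  have [Bx|Bx] := pselect (B x); last by rewrite fnB// indicE memNset// mulr0.
  by have [i Cx] := Cex x Bx; rewrite (fC i x Cx) indicE mem_set// mulr1.
have sumM : \sum_i m i = M.
  have -> : \sum_i m i = \sum_i 1 * m i by apply: eq_bigr => i _; rewrite mul1r.
  apply/eqP; rewrite -eqe -(integral_step (g := fun=> 1) mC (fun=> ler01) Cfin).
  rewrite /M fineK// -[in X in _ == X](setIT B) -integral_indic//; apply/eqP.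
  apply: eq_integral => x _; congr EFin.
  have [Bx|Bx] := pselect (B x); last first.
    rewrite [RHS]indicE memNset// big1// => i _; rewrite indicE memNset ?mulr0// => /CB.
    by [].
  have [i Cx] := Cex x Bx; rewrite [RHS]indicE mem_set//.
  rewrite (bigD1 i)//= indicE mem_set// mulr1 big1 ?addr0// => j ji.
  rewrite indicE memNset ?mulr0// => Cjx; move/eqP: ji; apply; exact: Cuniq Cjx Cx.
pose I := \sum_i F i * m i; have I0 : 0 <= I by rewrite sumr_ge0// => i _; rewrite mulr_ge0.
have IE : (\int[mu]_y (f y)%:E = I%:E)%E by exact: integral_step.
(* one cell with [F i > 0] suffices: there the discrete potential is at most 1 *)
have Ic : c * I <= 1.
  have [[i Fi]|noF] := pselect (exists i, 0 < F i).
    have [_ _ _ /(_ Fi) <-] := HF i.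
    apply: (@le_trans _ _ (\sum_j k i j * m j * F j)); last first.
      by rewrite lerDr mulr_ge0// ltW.
    rewrite /I mulr_sumr ler_sum// => j _.
    by rewrite -mulrA [F j * m j]mulrC ler_wpM2r// mulr_ge0.
  rewrite /I big1 ?mulr0// => i _; rewrite (_ : F i = 0) ?mul0r//.
  apply/eqP; rewrite eq_le F0 andbT leNgt; apply/negP => Fi; apply: noF; by exists i.
have IM : I <= M / e.
  rewrite -sumM mulr_suml ler_sum// => i _; rewrite mulrC ler_wpM2l//.
have th0 : 0 <= t / 2 by lra.
have dIe : d * I <= t / 2 * (M / (M + 1) ^+ 2).
  have -> : t / 2 * (M / (M + 1) ^+ 2) = d * (M / e) by rewrite /d; field; rewrite !gt_eqF.
  by rewrite ler_wpM2l// ltW.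
have M2 : 0 < (M + 1) ^+ 2 by exact: exprn_gt0.
have dI : d * I <= t / 2.
  apply: le_trans dIe _; rewrite ler_piMr// ler_pdivrMr// mul1r.
  by have := M0; clear; nra.
have dIM : d * I * M <= t / 2.
  apply: le_trans (ler_wpM2r M0 dIe) _.
  have -> : t / 2 * (M / (M + 1) ^+ 2) * M = t / 2 * (M * M / (M + 1) ^+ 2) by ring.
  rewrite ler_piMr// ler_pdivrMr// mul1r.
  by have := M0; clear; nra.
have eI : e * I <= t / 2.
  have -> : e * I = t / 2 * (c * I) by rewrite /e; field.
  exact: ler_piMr.
pose P := pot (fun x y => (kreg b h x y)%:E) mu f.
have cell i j x y : C i x -> C j y -> `|kreg b h x y - k i j| <= d.
  move=> Cx Cy; exact: (Hr _ _ _ _ (BL _ (CB _ _ Cx)) (BL _ (ctrB i))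
    (BL _ (CB _ _ Cy)) (BL _ (ctrB j)) (Cr _ _ Cx) (Cr _ _ Cy)).
have rP := @kernel_ge0_kreg R n b h.
have kmF i j : 0 <= k i j * m j * F j.
  by rewrite !mulr_ge0// (le_trans (ltW c0)).
have Pupper i x : C i x -> (P x <= (\sum_j k i j * m j * F j + d * I)%:E)%E.
  move=> Cx; have -> : \sum_j k i j * m j * F j + d * I =
      \sum_j ((k i j + d) * F j) * fine (mu (C j)).
    by rewrite /I mulr_sumr -big_split/=; apply: eq_bigr => j _; rewrite -/(m j); ring.
  have g0 j : 0 <= (k i j + d) * F j.
    by rewrite mulr_ge0// addr_ge0 ?(ltW d0)// (le_trans (ltW c0)).
  rewrite -integral_step//; apply: ge0_le_integral => //.
  - by move=> y _; exact: (integrand_ge0 x y rP fP).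
  - exact: (integrand_measurable x rP fP).
  - by apply/measurable_EFinP; apply: measurable_sum => j; apply: measurable_funM => //.
  move=> y _; rewrite -EFinM lee_fin /f mulr_sumr ler_sum// => j _.
  rewrite mulrA; have [Cy|Cy] := pselect (C j y); last by rewrite indicE memNset// !mulr0.
  rewrite indicE mem_set// !mulr1 ler_wpM2r//.
  by have := cell i j x y Cx Cy; rewrite ler_norml; lra.
have Plower i x : C i x -> ((\sum_j k i j * m j * F j)%:E <= P x + (d * I)%:E)%E.
  move=> Cx; have -> : \sum_j k i j * m j * F j = \sum_j (k i j * F j) * fine (mu (C j)).
    by apply: eq_bigr => j _; rewrite -/(m j); ring.
  have g0 j : 0 <= k i j * F j by rewrite mulr_ge0// (le_trans (ltW c0)).
  rewrite -integral_step// EFinM -IE -ge0_integralZl_EFin ?(ltW d0)//; last 2 first.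
  - by move=> y _; rewrite lee_fin.
  - exact/measurable_EFinP.
  rewrite /P /pot -ge0_integralD//; first last.
  - by apply: emeasurable_funM => //; exact/measurable_EFinP.
  - by move=> y _; rewrite mule_ge0// lee_fin// ltW.
  - exact: (integrand_measurable x rP fP).
  - by move=> y _; exact: (integrand_ge0 x y rP fP).
  apply: ge0_le_integral => //.
  - by move=> y _; rewrite lee_fin sumr_ge0// => j _; rewrite mulr_ge0.
  - by apply/measurable_EFinP; apply: measurable_sum => j; apply: measurable_funM => //.
  - apply: emeasurable_funD; first exact: (integrand_measurable x rP fP).
    by apply: emeasurable_funM => //; exact/measurable_EFinP.
  move=> y _; rewrite -!EFinM -EFinD lee_fin /f !mulr_sumr -big_split/= ler_sum// => j _.
  have [Cy|Cy] := pselect (C j y); last by rewrite indicE memNset// !mulr0 addr0.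
  rewrite indicE mem_set// !mulr1 -mulrDl ler_wpM2r//.
  by have := cell i j x y Cx Cy; rewrite ler_norml; lra.
have Kdiff x : (pot (kdiff b h) mu f x <= (t / 2)%:E)%E.
  have ei0 : 0 <= e^-1 by rewrite invr_ge0 ltW.
  have dP := @kernel_ge0_kdiff R n b h b0 (ltW h0).
  have H1 := pot_le_indic mu x ei0 dP fP mB fle.
  apply: (le_trans H1).
  apply: le_trans (lee_wpmul2l _ (Hh x)) _; first by rewrite lee_fin.
  rewrite -EFinM lee_fin (_ : e^-1 * _ = t / 2)//.
  by field; rewrite gt_eqF.
have ei0 : 0 <= e^-1 by rewrite invr_ge0 ltW.
have [p [cp pE]] := uniformly_regularizable_continuous b0 rmu cB uB fP ei0 fle.
have onF x : 0 < f x -> p x <= 1 + t.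
  move=> fx; have Bx : B x by apply: contrapT => Bx; rewrite fnB ?ltxx in fx.
  have [i Cx] := Cex x Bx; rewrite (fC i x Cx) in fx.
  have [_ _ _ /(_ fx) E] := HF i.
  rewrite -lee_fin -pE (pot_split mu x b0 (ltW h0) fP).
  apply: le_trans (leeD (Kdiff x) (Pupper i x Cx)) _.
  have eF : 0 <= e * F i by rewrite mulr_ge0// ltW.
  by rewrite -EFinD lee_fin; lra.
have all_le := frostman_maximum_principle b0 nb n0 cB fP fnB
  (eq_ind_r (fun u => (u <= I%:E)%E) (lexx _) IE) cp pE _ onF.
exists f; split => //.
  by move=> x; rewrite pE lee_fin; apply: all_le; lra.
have kmP := pot_measurable rmu kP fP.
apply: (@le_trans _ _ (\int[mu]_x (pot (kern b) mu f x * (\1_B x)%:E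
   + (e%:E * (f x)%:E + (d * I)%:E * (\1_B x)%:E)))%E).
  have -> : mu B = (\int[mu]_y (\1_B y)%:E)%E by rewrite integral_indic// setIT.
  apply: ge0_le_integral => //.
  - exact/measurable_EFinP.
  - apply: emeasurable_funD; last apply: emeasurable_funD; apply: emeasurable_funM => //.
    + exact/measurable_EFinP.
    + exact/measurable_EFinP.
    + exact/measurable_EFinP.
  move=> x _; have [Bx|Bx] := pselect (B x); last first.
    rewrite indicE memNset// !mule0 adde0 add0e mule_ge0// lee_fin//.
    exact: ltW.
  rewrite indicE mem_set// !mule1; have [i Cx] := Cex x Bx.
  have [_ _ H _] := HF i.
  rewrite (fC i x Cx) addeCA -EFinM.
  apply: (@le_trans _ _ ((e * F i)%:E + (\sum_j k i j * m j * F j)%:E)%E).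
    by rewrite -EFinD lee_fin.
  apply: leeD => //; apply: le_trans (Plower i x Cx) _; apply: leeD => //.
  rewrite (pot_split mu x b0 (ltW h0) fP) leeDr// pot_ge0//.
  by apply: kernel_ge0_kdiff => //; exact: ltW.
have dI0 : 0 <= d * I by rewrite mulr_ge0// ltW.
rewrite ge0_integralD//; first last.
- apply: emeasurable_funD; apply: emeasurable_funM => //; exact/measurable_EFinP.
- by move=> x _; rewrite adde_ge0// mule_ge0// lee_fin// ltW.
- by apply: emeasurable_funM => //; exact/measurable_EFinP.
- by move=> x _; rewrite mule_ge0// ?lee_fin// pot_ge0.
rewrite leeD2l// ge0_integralD//; first last.
- by apply: emeasurable_funM => //; exact/measurable_EFinP.
- by move=> x _; rewrite mule_ge0// lee_fin.
- by apply: emeasurable_funM => //; exact/measurable_EFinP.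
- by move=> x _; rewrite mule_ge0// lee_fin// ltW.
rewrite !ge0_integralZl_EFin ?(ltW e0)//; first last.
- exact/measurable_EFinP.
- by move=> x _; rewrite lee_fin.
- exact/measurable_EFinP.
rewrite IE integral_indic// setIT -(fineK muBfin) -/M -!EFinM -EFinD lee_fin.
by lra.
Qed.

End Equilibrium.

(** * Comparison of total masses *)

Section Mass.
Context (R : realType) (n : nat).
Implicit Types (x y z : 'rV[R]_n) (B K D S A : set 'rV[R]_n).
Implicit Types (mu nu : {measure set (borelRn R n) -> \bar R}).

(** Compact subsets of the exceptional set that lie in A have capacity zero. *)
Lemma ae_potential_le (alpha : R) A mu nu :
  radon mu -> radon nu -> concentrated mu A ->
  capacity_absolutely_continuous alpha mu ->
  nearly_everywhere alpha A
    (fun x => riesz_potential alpha mu x <= riesz_potential alpha nu x)%E ->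
  {ae mu, forall x, (riesz_potential alpha mu x <= riesz_potential alpha nu x)%E}.
Proof.
move=> rmu rnu [N [mN N0 AN]] ac ne.
have kP := @kernel_ge0_kern R n ((n%:R - alpha) / 2).
have oneP := @mfun_ge0_cst R n 1 ler01.
have m1 := pot_measurable rmu kP oneP; have m2 := pot_measurable rnu kP oneP.
rewrite -!riesz_potentialE in m1 m2.
pose E : set (borelRn R n) :=
  [set x | (riesz_potential alpha nu x < riesz_potential alpha mu x)%E].
have mE : measurable E.
  by rewrite -[X in measurable X]setTI; exact: measurable_lte.
have mS : measurable (E `\` N) by exact: measurableD.
have S0 : mu (E `\` N) = 0%E.
  apply: (capacity_ac_null rmu ac mS) => K cK KS.
  apply: inner_capacity0_sub ne => x Kx; have [Ex Nx] := KS x Kx; split.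
    by apply: contrapT => Ax; apply: Nx; exact: AN.
  by apply/negP; rewrite -ltNge.
apply: (@negligibleS _ _ _ mu ((E `\` N) `|` N)) => [x Hx|].
  have [Nx|Nx] := pselect (N x); first by right.
  by left; split => //=; rewrite /E/= ltNge; apply/negP.
by apply: negligibleU; [exists (E `\` N); split | exists N; split].
Qed.

Lemma infinite_potential_null (alpha : R) mu : alpha < n%:R ->
  radon_finite_potential alpha mu -> capacity_absolutely_continuous alpha mu ->
  mu [set x | riesz_potential alpha mu x = +oo%E] = 0%E.
Proof.
move=> an fmu ac; have [rmu _] := fmu.
apply: (capacity_ac_null rmu ac) => [|K cK Koo]; last first.
  exact: polar_infinity an cK fmu Koo.
have kP := @kernel_ge0_kern R n ((n%:R - alpha) / 2).
have oneP := @mfun_ge0_cst R n 1 ler01.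
have m1 := pot_measurable rmu kP oneP; rewrite -riesz_potentialE in m1.
rewrite -[X in measurable X]setTI; exact: (m1 measurableT _ (emeasurable_set1 +oo%E)).
Qed.

(** With [f mu] an approximate equilibrium measure of a large part B of K:
    [mu B] is nearly at most [int k(f mu) dmu = int k mu d(f mu)], which is at most
    [int k nu d(f mu) = int k(f mu) dnu], which is nearly at most [nu setT]. *)
Lemma compact_mass_le (alpha : R) mu nu K :
  (0 < n)%N -> alpha < n%:R -> alpha <= 2 -> radon mu -> radon nu ->
  mu [set x | riesz_potential alpha mu x = +oo%E] = 0%E ->
  {ae mu, forall x, (riesz_potential alpha mu x <= riesz_potential alpha nu x)%E} ->
  compact K -> (mu K <= nu setT)%E.
Proof.
move=> n0 an a2 rmu rnu muoo ae cK.
pose b := (n%:R - alpha) / 2; have b0 : 0 < b by rewrite divr_gt0// subr_gt0.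
have nb : n%:R <= 2 * b + 2 by rewrite /b; lra.
have kP := @kernel_ge0_kern R n b; have oneP := @mfun_ge0_cst R n 1 ler01.
have [->|nuoo] := eqVneq (nu setT) +oo%E; first exact: leey.
have nufin : nu setT \is a fin_num by rewrite ge0_fin_numE// ltey.
set V := fine (nu setT); have V0 : 0 <= V by exact: fine_ge0.
rewrite riesz_potentialE in muoo; rewrite !riesz_potentialE in ae.
apply/lee_addgt0Pr => e e0.
have e2 : 0 < e / 2 by rewrite divr_gt0.
have [B [cB BK muKB uB]] := exists_uniform_piece b0 rmu cK muoo e2.
pose t := e / 2 / (V + 1).
have t0 : 0 < t by rewrite divr_gt0//; lra.
have tV : t * V + t = e / 2 by rewrite /t; field; rewrite gt_eqF//; lra.
have [f [fP fle muB]] := exists_almost_equilibrium b0 nb n0 rmu cB uB t0.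
have f0 := proj2 fP; have mf := proj1 fP.
have mB := compact_measurable_rV cB.
have mmu := pot_measurable rmu kP oneP; have mnu := pot_measurable rnu kP oneP.
have mfp := pot_measurable rmu kP fP.
have kC := @kernC R n b.
apply: (le_trans muKB); apply: (le_trans (leeD2r _ muB)).
suff H : (\int[mu]_x (pot (kern b) mu f x * (\1_B x)%:E) <= ((1 + t) * V)%:E)%E.
  apply: (le_trans (leeD2r _ (leeD2r _ H))).
  by rewrite -(fineK nufin) -/V -!EFinD lee_fin; lra.
apply: (@le_trans _ _ (\int[mu]_x (pot (kern b) mu f x * 1%:E))%E).
  apply: ge0_le_integral => //.
  - by move=> x _; rewrite mule_ge0// ?lee_fin// pot_ge0.
  - by apply: emeasurable_funM => //; exact/measurable_EFinP.
  - by under eq_fun do rewrite mule1.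
  - move=> x _; apply: lee_wpmul2l; first exact: pot_ge0.
    by rewrite lee_fin indicE; case: (_ \in _).
rewrite (pot_exchange rmu rmu kC kP fP oneP).
apply: (@le_trans _ _ (\int[mu]_y (pot (kern b) nu (fun=> 1%R) y * (f y)%:E))%E).
  apply: ae_ge0_le_integral => //.
  - by move=> x _; rewrite mule_ge0// ?lee_fin// pot_ge0.
  - by apply: emeasurable_funM => //; exact/measurable_EFinP.
  - by move=> x _; rewrite mule_ge0// ?lee_fin// pot_ge0.
  - by apply: emeasurable_funM => //; exact/measurable_EFinP.
  - by apply: negligibleS ae => x; apply: contra_not => H _; apply: lee_wpmul2r; rewrite ?lee_fin.
rewrite -(pot_exchange rmu rnu kC kP fP oneP).
apply: (@le_trans _ _ (\int[nu]_x (cst (1 + t)%:E x))%E).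
  apply: ge0_le_integral => //.
  - by move=> x _; rewrite mule1 pot_ge0.
  - by under eq_fun do rewrite mule1.
  - by move=> x _; rewrite mule1; exact: fle.
by rewrite integral_cst// -(fineK nufin) -/V -EFinM.
Qed.

End Mass.

Unset Implicit Arguments.

Theorem theorem1p5 (R : realType) (n : nat) (alpha : R)
    (hn : (2 <= n)%N)
    (halpha0 : 0 < alpha) (halpha2 : alpha <= 2) (halphan : alpha < n%:R)
    (A : set 'rV[R]_n)
    (mu nu : {measure set (borelRn R n) -> \bar R})
    (hmu : radon_on alpha A mu) (hnu : radon_on alpha A nu)
    (hmuc : capacity_absolutely_continuous alpha mu)
    (hnuc : capacity_absolutely_continuous alpha nu)
    (hle : nearly_everywhere alpha A
       (fun x => riesz_potential alpha mu x <= riesz_potential alpha nu x)%E) :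
  (mu setT <= nu setT)%E.
Proof.
have [fmu muA] := hmu; have [[rnu _] _] := hnu; have [rmu _] := fmu.
have muoo := infinite_potential_null halphan fmu hmuc.
have ae := ae_potential_le rmu rnu muA hmuc hle.
have [_ reg] := rmu; rewrite reg//.
apply: ge_ereal_sup => _ [K [cK _] <-].
by apply: compact_mass_le ae cK => //; exact: ltnW.
Qed.
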